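(* Let $K$ be an algebraically closed field of characteristic $p>0$. Then for all but finitely many elliptic curves $C$ over $K$ (up to isomorphism), there is a nontrivial Artin–Schreier extension of the function field $F$ of $C$ that splits over each completion $F_v$ of $F$ at a discrete valuation $v$ of $F$. As a consequence, the local-global principle for Levi factors over $F$ fails; that is, there exists a linear algebraic group $G$ over $F$ whose unipotent radical is defined over $F$ such that $G$ has no Levi factor over $F$, but for every discrete valuation $v$ on $F$ the base change $G_{F_v}$ has a Levi factor over $F_v$.
   Context: A linear algebraic group over a field $F$ is a smooth affine group scheme of finite type over $F$ (not necessarily connected). Over an algebraically closed field, the unipotent radical $R_u(G)$ is the largest connected normal unipotent subgroup of $G$, and $G$ is called reductive if $R_u(G)$ is trivial (so reductive groups need not be connected). For $G$ over a field $F$ with algebraic closure $\bar F$, the unipotent radical of $G$ is said to be defined over $F$ if the largest connected normal unipotent $F$-subgroup $U$ of $G$ satisfies $U_{\bar F}=R_u(G_{\bar F})$; in that case one writes $R_u(G)=U$. A Levi factor of such a $G$ (over $F$) is an $F$-subgroup $M\subseteq G$ that maps isomorphically onto $G/R_u(G)$ under the quotient map; equivalently, it is the image of a homomorphic section of $G\to G/R_u(G)$ over $F$. For a discrete valuation $v$ on $F$, $F_v$ denotes the $v$-adic completion of $F$. An Artin–Schreier extension of a field $F$ of characteristic $p$ is an extension given by an equation $Y^p-Y=f$ with $f\in F$. It is nontrivial if $Y^p-Y-f$ has no root in $F$ (it is then a Galois extension of degree $p$), and it splits over a field extension $E$ of $F$ if $Y^p-Y-f$ has a root in $E$ (equivalently,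 splits into linear factors over $E$). *)

(* Defs.v *)
From HB Require Import structures.
From mathcomp Require Import all_boot all_order all_algebra.
From mathcomp.multinomials Require Export mpoly.

Set Implicit Arguments.
Unset Strict Implicit.
Unset Printing Implicit Defensive.

Import Order.TTheory GRing.Theory Num.Theory.
Local Open Scope ring_scope.

(** * Elliptic curves and their function fields *)

Record weierstrass (K : fieldType) := Weierstrass {
  wa1 : K; wa2 : K; wa3 : K; wa4 : K; wa6 : K }.

(* Left-hand side minus right-hand side of
     y^2 + a1 x y + a3 y = x^3 + a2 x^2 + a4 x + a6
   in a commutative K-algebra R with structure map s. *)
Definition weval (K : fieldType) (W : weierstrass K) (R : comNzRingType)
    (s : K -> R) (x y : R) : R :=
  y ^+ 2 + s (wa1 W) * x * y + s (wa3 W) * y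
  - (x ^+ 3 + s (wa2 W) * x ^+ 2 + s (wa4 W) * x + s (wa6 W)).

Definition wvarx (K : fieldType) : {mpoly K[2]} := 'X_(inord 0).
Definition wvary (K : fieldType) : {mpoly K[2]} := 'X_(inord 1).

Definition wpoly (K : fieldType) (W : weierstrass K) : {mpoly K[2]} :=
  weval W (@mpolyC 2 K) (wvarx K) (wvary K).

(* Jacobian criterion on the affine part; the projective closure has one more
   point, [0 : 1 : 0], and it is always a smooth point.  This is smoothness of
   the curve when K is algebraically closed. *)
Definition wsmooth (K : fieldType) (W : weierstrass K) : Prop :=
  forall P : 'I_2 -> K,
    ~ ((wpoly W).@[P] = 0 /\ forall i : 'I_2, ((wpoly W)^`M(i)).@[P] = 0).

Record ellipticCurve (K : closedFieldType) := EllipticCurve {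
  ecurve :> weierstrass K;
  _ : wsmooth ecurve }.

(* Admissible change of variables x = u^2 x' + r, y = u^3 y' + u^2 s x' + t. *)
Definition elliptic_iso (K : closedFieldType) (C D : ellipticCurve K) : Prop :=
  exists u r s t : K, u != 0 /\
    weval C (@mpolyC 2 K)
      (u ^+ 2 *: wvarx K + r%:MP)
      (u ^+ 3 *: wvary K + (u ^+ 2 * s) *: wvarx K + t%:MP)
    = u ^+ 6 *: wpoly D.

(* F, with structure map s, is the fraction field of K[X, Y] / (wpoly W): the
   kernel of q |-> q(x, y) is the ideal (wpoly W), and every element of F is a
   quotient of values of polynomials at (x, y). *)
Definition is_function_field (K : fieldType) (W : weierstrass K)
    (F : fieldType) (s : {rmorphism K -> F}) : Prop :=
  exists P : 'I_2 -> F,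
    (forall q : {mpoly K[2]},
       mmap s P q = 0 <-> exists c : {mpoly K[2]}, q = c * wpoly W)
    /\ (forall z : F, exists q r : {mpoly K[2]},
          mmap s P r != 0 /\ z = mmap s P q / mmap s P r).

(** * Discrete valuations and completions *)

(* Normalized discrete valuations; the value at 0 (+oo) is left unspecified. *)
Record discreteValuation (F : fieldType) := DiscreteValuation {
  dval :> F -> int;
  _ : forall x y, x != 0 -> y != 0 -> dval (x * y) = dval x + dval y;
  _ : forall x y, x != 0 -> y != 0 -> x + y != 0 ->
        Num.min (dval x) (dval y) <= dval (x + y);
  _ : exists x, x != 0 /\ dval x = 1 }.

Definition dval_close (F : fieldType) (v : discreteValuation F) (n : int)
    (x y : F) : Prop := x != y -> n <= v (x - y).

Definition dval_complete (F : fieldType) (v : discreteValuation F) : Prop :=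
  forall u : nat -> F,
    (forall n : int, exists N : nat, forall i j : nat,
       (N <= i)%N -> (N <= j)%N -> dval_close v n (u i) (u j)) ->
    exists l : F, forall n : int, exists N : nat, forall i : nat,
       (N <= i)%N -> dval_close v n (u i) l.

(* (Fv, iota) is the v-adic completion of F: Fv is complete for a discrete
   valuation extending v, and F is dense in it. *)
Definition is_completion (F : fieldType) (v : discreteValuation F)
    (Fv : fieldType) (iota : {rmorphism F -> Fv}) : Prop :=
  exists w : discreteValuation Fv,
    [/\ forall x, x != 0 -> w (iota x) = v x,
        dval_complete w
      & forall (y : Fv) (n : int), exists x : F, dval_close w n y (iota x)].

(** * Artin-Schreier extensions *)

Definition artin_schreier (p : nat) (F : fieldType) (f : F) : {poly F} :=
  'X^p - 'X - f%:P.

Definition as_nontrivial (p : nat) (F : fieldType) (f : F) : Prop :=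
  ~ exists y : F, root (artin_schreier p f) y.

Definition as_splits_over (p : nat) (F : fieldType) (f : F)
    (E : fieldType) (iota : {rmorphism F -> E}) : Prop :=
  exists y : E, root (map_poly iota (artin_schreier p f)) y.

(** * Affine schemes of finite type

   A closed subscheme of affine n-space over F is given by a finite list of
   equations in {mpoly F[n]}.  An F-algebra is a commutative ring R with a
   structure map s : {rmorphism F -> R}; the R-points of the subscheme are the
   x in R^n that satisfy [on_scheme X s x].  Properties of (maps of) schemes are
   expressed on R-points for all F-algebras R. *)

Section Points.
Variables (F : fieldType) (R : comNzRingType) (s : {rmorphism F -> R}).

Definition on_scheme (n : nat) (X : seq {mpoly F[n]}) (x : {ffun 'I_n -> R}) :
    Prop :=
  forall f, f \in X -> mmap s x f = 0.

Definition map_pt (m n : nat) (phi : {ffun 'I_n -> {mpoly F[m]}})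
    (x : {ffun 'I_m -> R}) : {ffun 'I_n -> R} :=
  [ffun i => mmap s x (phi i)].

Definition const_pt (n : nat) (c : {ffun 'I_n -> F}) : {ffun 'I_n -> R} :=
  [ffun i => s (c i)].

Definition pair_pt (m n : nat) (x : {ffun 'I_m -> R}) (y : {ffun 'I_n -> R}) :
    {ffun 'I_(m + n) -> R} :=
  [ffun i => match split i with inl j => x j | inr j => y j end].

End Points.

(* Formal smoothness (infinitesimal lifting along surjections R -> R' with
   square-zero kernel); finite presentation is built in. *)
Definition scheme_smooth (F : fieldType) (n : nat) (X : seq {mpoly F[n]}) :
    Prop :=
  forall (R R' : comNzRingType) (s : {rmorphism F -> R})
         (q : {rmorphism R -> R'}),
    (forall b : R', exists a : R, q a = b) ->
    (forall a b : R, q a = 0 -> q b = 0 -> a * b = 0) ->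
    forall x' : {ffun 'I_n -> R'}, on_scheme (q \o s) X x' ->
    exists x : {ffun 'I_n -> R},
      on_scheme s X x /\ x' = [ffun i => q (x i)].

Definition in_ideal (F : fieldType) (n : nat) (X : seq {mpoly F[n]})
    (f : {mpoly F[n]}) : Prop :=
  exists c : 'I_(size X) -> {mpoly F[n]}, f = \sum_i c i * X`_i.

(* The coordinate ring is nonzero and has no idempotents other than 0 and 1. *)
Definition scheme_connected (F : fieldType) (n : nat) (X : seq {mpoly F[n]}) :
    Prop :=
  ~ in_ideal X 1 /\
  forall e : {mpoly F[n]}, in_ideal X (e ^+ 2 - e) ->
    in_ideal X e \/ in_ideal X (1 - e).

(** * Affine group schemes of finite type *)

Section GroupLaws.
Variables (F : fieldType) (n : nat) (X : seq {mpoly F[n]}).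
Variables (mul : {ffun 'I_n -> {mpoly F[n + n]}}).
Variables (inv : {ffun 'I_n -> {mpoly F[n]}}) (one : {ffun 'I_n -> F}).

Definition closed_under_group_laws (R : comNzRingType) (s : {rmorphism F -> R}) :
    Prop :=
  [/\ on_scheme s X (const_pt s one),
      forall x, on_scheme s X x -> on_scheme s X (map_pt s inv x)
    & forall x y, on_scheme s X x -> on_scheme s X y ->
        on_scheme s X (map_pt s mul (pair_pt x y))].

Definition satisfies_group_axioms (R : comNzRingType) (s : {rmorphism F -> R}) :
    Prop :=
  let mulp x y := map_pt s mul (pair_pt x y) in
  [/\ forall x y z, on_scheme s X x -> on_scheme s X y -> on_scheme s X z ->
        mulp x (mulp y z) = mulp (mulp x y) z,
      forall x, on_scheme s X x -> mulp (const_pt s one) x = x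
    & forall x, on_scheme s X x ->
        mulp (map_pt s inv x) x = const_pt s one].

End GroupLaws.

Record groupScheme (F : fieldType) := GroupScheme {
  gdim : nat;
  geqs : seq {mpoly F[gdim]};
  gmul : {ffun 'I_gdim -> {mpoly F[gdim + gdim]}};
  ginv : {ffun 'I_gdim -> {mpoly F[gdim]}};
  gone : {ffun 'I_gdim -> F};
  gclosedP : forall (R : comNzRingType) (s : {rmorphism F -> R}),
    closed_under_group_laws geqs gmul ginv gone s;
  gaxiomsP : forall (R : comNzRingType) (s : {rmorphism F -> R}),
    satisfies_group_axioms geqs gmul ginv gone s }.

Section GroupPoints.
Variables (F : fieldType) (G : groupScheme F).
Variables (R : comNzRingType) (s : {rmorphism F -> R}).

Definition in_group (x : {ffun 'I_(gdim G) -> R}) : Prop :=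
  on_scheme s (geqs G) x.
Definition mul_pt (x y : {ffun 'I_(gdim G) -> R}) : {ffun 'I_(gdim G) -> R} :=
  map_pt s (gmul G) (pair_pt x y).
Definition inv_pt (x : {ffun 'I_(gdim G) -> R}) : {ffun 'I_(gdim G) -> R} :=
  map_pt s (ginv G) x.
Definition one_pt : {ffun 'I_(gdim G) -> R} := const_pt s (gone G).

End GroupPoints.

Definition is_linear_algebraic_group (F : fieldType) (G : groupScheme F) : Prop :=
  scheme_smooth (geqs G).

(** Closed subgroup schemes *)

Record subgroupScheme (F : fieldType) (G : groupScheme F) := SubgroupScheme {
  seqs : seq {mpoly F[gdim G]};
  seqs_sub : forall (R : comNzRingType) (s : {rmorphism F -> R}) x,
    on_scheme s seqs x -> in_group s x;
  sclosedP : forall (R : comNzRingType) (s : {rmorphism F -> R}),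
    closed_under_group_laws seqs (gmul G) (ginv G) (gone G) s }.

Definition in_subgroup (F : fieldType) (G : groupScheme F)
    (H : subgroupScheme G) (R : comNzRingType) (s : {rmorphism F -> R})
    (x : {ffun 'I_(gdim G) -> R}) : Prop :=
  on_scheme s (seqs H) x.

Lemma sub_axiomsP (F : fieldType) (G : groupScheme F) (H : subgroupScheme G)
    (R : comNzRingType) (s : {rmorphism F -> R}) :
  satisfies_group_axioms (seqs H) (gmul G) (ginv G) (gone G) s.
Proof.
have [A U V] := gaxiomsP G s; split=> [x y z hx hy hz|x hx|x hx].
- by apply: A; apply: (@seqs_sub _ _ H).
- by apply: U; apply: (@seqs_sub _ _ H).
- by apply: V; apply: (@seqs_sub _ _ H).
Qed.

Definition group_of_sub (F : fieldType) (G : groupScheme F)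
    (H : subgroupScheme G) : groupScheme F :=
  GroupScheme (@sclosedP _ _ H) (@sub_axiomsP _ _ H).

Definition sub_included (F : fieldType) (G : groupScheme F)
    (H H' : subgroupScheme G) : Prop :=
  forall (R : comNzRingType) (s : {rmorphism F -> R}) x,
    in_subgroup H s x -> in_subgroup H' s x.

Definition sub_normal (F : fieldType) (G : groupScheme F)
    (N : subgroupScheme G) : Prop :=
  forall (R : comNzRingType) (s : {rmorphism F -> R}) g x,
    in_group s g -> in_subgroup N s x ->
    in_subgroup N s (mul_pt s (mul_pt s g x) (inv_pt s g)).

(** Unipotent groups: every nonzero finite-dimensional representation has a
   nonzero fixed vector. *)

Definition is_representation (F : fieldType) (G : groupScheme F) (m : nat)
    (rho : 'M[{mpoly F[gdim G]}]_m) : Prop :=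
  forall (R : comNzRingType) (s : {rmorphism F -> R}),
    map_mx (mmap s (one_pt G s)) rho = 1%:M /\
    forall x y : {ffun 'I_(gdim G) -> R}, in_group s x -> in_group s y ->
      map_mx (mmap s (mul_pt s x y)) rho
      = map_mx (mmap s x) rho *m map_mx (mmap s y) rho.

Definition unipotent (F : fieldType) (G : groupScheme F) : Prop :=
  forall (m : nat) (rho : 'M[{mpoly F[gdim G]}]_m.+1),
    is_representation rho ->
    exists v : 'cV[F]_m.+1, v != 0 /\
      forall (R : comNzRingType) (s : {rmorphism F -> R})
             (x : {ffun 'I_(gdim G) -> R}), in_group s x ->
        map_mx (mmap s x) rho *m map_mx s v = map_mx s v.

(** Base change *)

Section BaseChange.
Variables (F E : fieldType) (iota : {rmorphism F -> E}).

Definition bc_eqs (n : nat) (X : seq {mpoly F[n]}) : seq {mpoly E[n]} :=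
  map (map_mpoly iota) X.
Definition bc_map (m n : nat) (phi : {ffun 'I_n -> {mpoly F[m]}}) :
    {ffun 'I_n -> {mpoly E[m]}} :=
  [ffun i => map_mpoly iota (phi i)].
Definition bc_const (n : nat) (c : {ffun 'I_n -> F}) : {ffun 'I_n -> E} :=
  [ffun i => iota (c i)].

Section Points.
Variables (R : comNzRingType) (s : {rmorphism E -> R}).

Lemma mmap_bc (n : nat) (x : 'I_n -> R) (f : {mpoly F[n]}) :
  mmap s x (map_mpoly iota f) = mmap (s \o iota) x f.
Proof.
rewrite /map_mpoly [mmap _ (fun _ => _) f]/mmap raddf_sum /=.
apply: eq_bigr => m _.
by rewrite rmorphM /= mmapC mmap1_id mmapX.
Qed.

Lemma on_scheme_bc (n : nat) (X : seq {mpoly F[n]}) (x : {ffun 'I_n -> R}) :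
  on_scheme s (bc_eqs X) x <-> on_scheme (s \o iota) X x.
Proof.
split=> h f; first by move=> fX; rewrite -mmap_bc h // map_f.
by case/mapP=> g gX ->; rewrite mmap_bc h.
Qed.

Lemma map_pt_bc (m n : nat) (phi : {ffun 'I_n -> {mpoly F[m]}}) x :
  map_pt s (bc_map phi) x = map_pt (s \o iota) phi x.
Proof. by apply/ffunP=> i; rewrite !ffunE mmap_bc. Qed.

Lemma const_pt_bc (n : nat) (c : {ffun 'I_n -> F}) :
  const_pt s (bc_const c) = const_pt (s \o iota) c.
Proof. by apply/ffunP=> i; rewrite !ffunE. Qed.

Lemma bc_closedP (n : nat) (X : seq {mpoly F[n]}) mul inv one :
  closed_under_group_laws X mul inv one (s \o iota) ->
  closed_under_group_laws (bc_eqs X) (bc_map mul) (bc_map inv) (bc_const one) s.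
Proof.
case=> h1 h2 h3; split=> [|x|x y].
- by rewrite const_pt_bc; apply/on_scheme_bc.
- by rewrite map_pt_bc !on_scheme_bc; apply: h2.
- by rewrite map_pt_bc !on_scheme_bc; apply: h3.
Qed.

Lemma bc_axiomsP (n : nat) (X : seq {mpoly F[n]}) mul inv one :
  satisfies_group_axioms X mul inv one (s \o iota) ->
  satisfies_group_axioms (bc_eqs X) (bc_map mul) (bc_map inv) (bc_const one) s.
Proof.
case=> h1 h2 h3; split=> [x y z|x|x]; rewrite !on_scheme_bc !map_pt_bc.
- exact: h1.
- by rewrite const_pt_bc; apply: h2.
- by rewrite const_pt_bc; apply: h3.
Qed.

End Points.

Definition base_change (G : groupScheme F) : groupScheme E :=
  GroupScheme (fun R s => bc_closedP (gclosedP G (s \o iota)))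
              (fun R s => bc_axiomsP (gaxiomsP G (s \o iota))).

Lemma bc_seqs_sub (G : groupScheme F) (H : subgroupScheme G)
    (R : comNzRingType) (s : {rmorphism E -> R}) x :
  on_scheme s (bc_eqs (seqs H)) x -> in_group (G := base_change G) s x.
Proof. by rewrite /in_group !on_scheme_bc; apply: seqs_sub. Qed.

Definition base_change_sub (G : groupScheme F) (H : subgroupScheme G) :
    subgroupScheme (base_change G) :=
  @SubgroupScheme E (base_change G) (bc_eqs (seqs H)) (@bc_seqs_sub G H)
    (fun R s => bc_closedP (@sclosedP _ _ H R (s \o iota))).

End BaseChange.

(** * Unipotent radical, quotients and Levi factors *)

(* F-subgroups are linear algebraic groups, hence smooth. *)
Definition sm_conn_normal_unip (F : fieldType) (G : groupScheme F)
    (N : subgroupScheme G) : Prop :=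
  [/\ scheme_smooth (seqs N), scheme_connected (seqs N), sub_normal N
    & unipotent (group_of_sub N)].

Definition is_largest_sm_conn_normal_unip (F : fieldType) (G : groupScheme F)
    (U : subgroupScheme G) : Prop :=
  sm_conn_normal_unip U /\
  forall N : subgroupScheme G, sm_conn_normal_unip N -> sub_included N U.

(* L is algebraically closed, being a closedFieldType. *)
Definition is_algebraic_closure (F : fieldType) (L : closedFieldType)
    (iota : {rmorphism F -> L}) : Prop :=
  forall z : L, algebraicOver iota z.

(* The unipotent radical of G is defined over F and R_u(G) = U. *)
Definition is_unipotent_radical (F : fieldType) (G : groupScheme F)
    (U : subgroupScheme G) : Prop :=
  is_largest_sm_conn_normal_unip U /\
  forall (L : closedFieldType) (iota : {rmorphism F -> L}),
    is_algebraic_closure iota ->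
    is_largest_sm_conn_normal_unip (base_change_sub iota U).

Definition group_hom_data (F : fieldType) (G H : groupScheme F) : Type :=
  {ffun 'I_(gdim H) -> {mpoly F[gdim G]}}.

Definition is_group_hom (F : fieldType) (G H : groupScheme F)
    (phi : group_hom_data G H) : Prop :=
  forall (R : comNzRingType) (s : {rmorphism F -> R}),
    (forall x, in_group s x -> in_group s (map_pt s phi x)) /\
    (forall x y, in_group s x -> in_group s y ->
       map_pt s phi (mul_pt s x y)
       = mul_pt s (map_pt s phi x) (map_pt s phi y)).

(* Two tuples of polynomials induce the same morphism on G. *)
Definition same_hom (F : fieldType) (G H : groupScheme F)
    (phi psi : group_hom_data G H) : Prop :=
  forall (R : comNzRingType) (s : {rmorphism F -> R}) x, in_group s x ->
    map_pt s phi x = map_pt s psi x.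

Definition comp_hom (F : fieldType) (G H J : groupScheme F)
    (psi : group_hom_data H J) (phi : group_hom_data G H) :
    group_hom_data G J :=
  [ffun i => mmap (@mpolyC _ F) phi (psi i)].

Definition trivial_on (F : fieldType) (G H : groupScheme F)
    (N : subgroupScheme G) (phi : group_hom_data G H) : Prop :=
  forall (R : comNzRingType) (s : {rmorphism F -> R}) x, in_subgroup N s x ->
    map_pt s phi x = one_pt H s.

(* pi : G -> Q is the quotient of G by the normal subgroup N: its kernel is N
   and every homomorphism that is trivial on N factors uniquely through pi. *)
Definition is_quotient (F : fieldType) (G : groupScheme F)
    (N : subgroupScheme G) (Q : groupScheme F) (pi : group_hom_data G Q) :
    Prop :=
  [/\ is_group_hom pi,
      forall (R : comNzRingType) (s : {rmorphism F -> R}) x, in_group s x ->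
        (map_pt s pi x = one_pt Q s <-> in_subgroup N s x)
    & forall (H : groupScheme F) (phi : group_hom_data G H),
        is_group_hom phi -> trivial_on N phi ->
        exists psi : group_hom_data Q H,
          [/\ is_group_hom psi, same_hom (comp_hom psi pi) phi
            & forall psi' : group_hom_data Q H, is_group_hom psi' ->
                same_hom (comp_hom psi' pi) phi -> same_hom psi' psi]].

(* The restriction of pi to M is an isomorphism onto Q, with inverse sigma. *)
Definition restricts_to_iso (F : fieldType) (G Q : groupScheme F)
    (M : subgroupScheme G) (pi : group_hom_data G Q) : Prop :=
  exists sigma : group_hom_data Q G,
    is_group_hom sigma /\
    forall (R : comNzRingType) (s : {rmorphism F -> R}),
      [/\ forall y, in_group s y -> in_subgroup M s (map_pt s sigma y),
          forall y, in_group s y -> map_pt s pi (map_pt s sigma y) = y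
        & forall x, in_subgroup M s x -> map_pt s sigma (map_pt s pi x) = x].

Definition is_levi_factor (F : fieldType) (G : groupScheme F)
    (M : subgroupScheme G) : Prop :=
  scheme_smooth (seqs M) /\
  exists (U : subgroupScheme G) (Q : groupScheme F) (pi : group_hom_data G Q),
    [/\ is_unipotent_radical U, is_quotient U pi & restricts_to_iso M pi].

Definition unipotent_radical_defined (F : fieldType) (G : groupScheme F) : Prop :=
  exists U : subgroupScheme G, is_unipotent_radical U.

Definition has_levi_factor (F : fieldType) (G : groupScheme F) : Prop :=
  exists M : subgroupScheme G, is_levi_factor M.

(* Main.v *)
Require Import Defs.
From HB Require Import structures.
From mathcomp Require Import all_boot all_order all_algebra.
From mathcomp Require Import generic_quotient ring_quotient ring zify.
From Stdlib Require Import Classical ClassicalEpsilon.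
Set Implicit Arguments.
Unset Strict Implicit.
Unset Printing Implicit Defensive.
Import Order.TTheory GRing.Theory Num.Theory.
Local Open Scope ring_scope.

(* Away from the finitely many supersingular curves, take a function f with
   simple poles exactly at the origin O and at a 2-torsion point Q, scaled by
   the Hasse invariant so that f^p - f = h + h' with h regular off O and h'
   regular at O.  Then h is locally of the form z^p - z: modulo a constant at
   the places other than O, and up to f at O.  If h = z^p - z globally, then
   z - f would be regular off Q, and z would have a single simple pole, at O;
   this is replaced below by comparing coefficients and degrees in the basis
   (1, y) of F over K(x).

   Let G be the extension of (Z/p)^2 by G_a^2 with points (u, z, a, b), where
   b acts on G_a^2 by (u, z) |-> (u, z + b (u^p - u)) and where the commutator
   of the obvious lifts of the two generators is h.  Its radical is the connected
   component G_a^2.  Moving the lift of the first generator by u changes the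
   commutator by u^p - u, so G has a Levi factor over E exactly if h = y^p - y
   is solvable in E. *)

(** * Points of affine schemes and their coordinate rings *)

(** Since all residue fields are [K], an extension that splits over every completion is an
    everywhere unramified one. The nontrivial ones correspond to nonzero Frobenius-fixed classes in
    H^1(C, O_C). This space is a line on which Frobenius is p-linear, given by the Hasse invariant,
    whence the restriction to ordinary curves. The function f is a cocycle for the covering of C by
    the complements of O and Q; the scaling makes its class Frobenius-fixed, and f^p - f = h + h'
    writes the difference as a coboundary. A valuation is known here only by its axioms, so it has
    to be shown that it vanishes on constants and that x and y, where integral, have residues in
    [K]. If G_a^2 were central in G, the commutator would not depend on the lifts and the
    obstruction would be h itself. The action of b brings in u^p - u and turns the obstruction into
    the class of h modulo the elements y^p - y. *)

Section Mmap.
Variables (n : nat) (F R S : comNzRingType).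

Lemma mpoly_ring_ind (P : {mpoly F[n]} -> Prop) :
  (forall c, P c%:MP) -> (forall i, P 'X_i) ->
  (forall q r, P q -> P r -> P (q + r)) ->
  (forall q r, P q -> P r -> P (q * r)) -> forall q, P q.
Proof.
move=> PC PX PD PM; elim/mpolyind=> [|c m q _ _ Pq]; first by rewrite -mpolyC0.
apply: (PD) => //; rewrite -mul_mpolyC; apply: (PM) => //.
rewrite mpolyXE_id; apply: (big_ind P) => [|x y|i _]; first exact: PC 1.
- exact: PM.
- by elim: (m i) => [|k IH]; [exact: PC 1 | rewrite exprS; apply: (PM)].
Qed.

Lemma rmorph_mmap (s : {rmorphism F -> R}) (phi : {rmorphism R -> S})
    (h : 'I_n -> R) (q : {mpoly F[n]}) :
  phi (mmap s h q) = mmap (phi \o s) (phi \o h) q.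
Proof.
elim/mpoly_ring_ind: q => [c|i|q r Hq Hr|q r Hq Hr].
- by rewrite !mmapC.
- by rewrite !mmapX !mmap1U.
- by rewrite !rmorphD Hq Hr.
- by rewrite !rmorphM Hq Hr.
Qed.

Lemma eq_mmap (f1 f2 : F -> R) (h1 h2 : 'I_n -> R) :
  f1 =1 f2 -> h1 =1 h2 -> mmap f1 h1 =1 mmap f2 h2.
Proof.
move=> ef eh q; apply: eq_bigr => m _; rewrite ef; congr (_ * _).
exact: mmap1_eq.
Qed.
End Mmap.

Section Ideals.
Variables (F : fieldType) (n : nat) (X : seq {mpoly F[n]}).
Implicit Types q r : {mpoly F[n]}.

Lemma in_ideal0 : in_ideal X 0.
Proof. by exists (fun=> 0); rewrite big1 // => i _; rewrite mul0r. Qed.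

Lemma in_idealMD q f g :
  in_ideal X f -> in_ideal X g -> in_ideal X (q * f + g).
Proof.
move=> [c ->] [d ->]; exists (fun i => q * c i + d i).
by rewrite mulr_sumr -big_split; apply: eq_bigr => i _; rewrite mulrDl mulrA.
Qed.

Lemma in_idealD f g : in_ideal X f -> in_ideal X g -> in_ideal X (f + g).
Proof. by move=> hf; rewrite -[f]mul1r; apply: in_idealMD. Qed.

Lemma in_idealM q f : in_ideal X f -> in_ideal X (q * f).
Proof. by move=> hf; rewrite -[_ * _]addr0; apply/in_idealMD/in_ideal0. Qed.

Lemma mem_in_ideal f : f \in X -> in_ideal X f.
Proof.
move=> fX; have lt_fX : (index f X < size X)%N by rewrite index_mem.
exists (fun i => (i == Ordinal lt_fX)%:R).
rewrite (bigD1 (Ordinal lt_fX)) //= eqxx mul1r nth_index // big1 ?addr0 //.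
by move=> i /negPf->; rewrite mul0r.
Qed.

Lemma in_ideal_vanish (R : comNzRingType) (s : {rmorphism F -> R}) x f :
  on_scheme s X x -> in_ideal X f -> mmap s x f = 0.
Proof.
move=> hx [c ->]; rewrite raddf_sum big1 //= => i _.
by rewrite rmorphM /= (hx X`_i) ?mulr0 // mem_nth.
Qed.

(* The tautological point over the coordinate ring F[x_1, ..., x_n] / (X). *)
Lemma exists_generic_point : ~ in_ideal X 1 ->
  exists (R : comNzRingType) (s : {rmorphism F -> R}) (x : {ffun 'I_n -> R}),
    on_scheme s X x /\ forall f, mmap s x f = 0 -> in_ideal X f.
Proof.
move=> X1.
(* The ideal quotient needs a boolean predicate, while membership in the ideal is only a
   proposition: hence the classical choice. *)
pose I : {mpoly F[n]} -> bool := fun f =>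
  if excluded_middle_informative (in_ideal X f) then true else false.
have IP f : reflect (in_ideal X f) (f \in I).
  rewrite /in_mem /= /I; case: excluded_middle_informative => ?; by constructor.
have Iideal : idealr_closed I.
  split=> [||a u v /IP hu /IP hv]; [exact/IP/in_ideal0 | exact/IP |].
  exact/IP/in_idealMD.
pose J : idealr _ := HB.pack I (isIdealr.Build _ _ Iideal).
pose pi : {rmorphism _ -> {ideal_quot J}} := \pi_{ideal_quot J}%qT.
have pi0 f : pi f = 0 <-> in_ideal X f.
  rewrite -(rmorph0 pi); split=> [/eqP|/IP If].
    by rewrite /pi -Quotient.idealrBE subr0 => /IP.
  by apply/eqP; rewrite /pi -Quotient.idealrBE subr0.
have piE f : mmap (pi \o @mpolyC n F) [ffun i => pi 'X_i] f = pi f.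
  rewrite -[f in RHS](@comp_mpoly_id n) /comp_mpoly rmorph_mmap /=.
  by apply: eq_mmap => // i; rewrite ffunE /= tnth_mktuple.
exists {ideal_quot J}, (pi \o @mpolyC n F), [ffun i => pi 'X_i].
split=> f; rewrite piE; last by move/pi0.
by move/mem_in_ideal/pi0.
Qed.

(* On a connected scheme the idempotent x_i ^+ p.-1 is 0 or 1. *)
Lemma connected_coord0 (p : nat) (i : 'I_n) (c : {ffun 'I_n -> F}) :
  prime p -> scheme_connected X ->
  (forall (R : comNzRingType) (s : {rmorphism F -> R}) x,
     on_scheme s X x -> x i ^+ p = x i) ->
  on_scheme idfun X c -> c i = 0 ->
  forall (R : comNzRingType) (s : {rmorphism F -> R}) x,
    on_scheme s X x -> x i = 0.
Proof.
case: p => [|[|k]] // _ [X1 Xconn] Xp Xc ci R s x Xx.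
(* The generic point turns x_i^p = x_i into the ideal membership that makes x_i^(p-1) idempotent.
   The value 1 is then excluded at [c]. *)
have [R' [s' [x' [Xx' x'0]]]] := exists_generic_point X1.
have [|/(in_ideal_vanish Xx)|/(in_ideal_vanish Xc)] := Xconn ('X_i ^+ k.+1).
- apply: x'0; rewrite rmorphB !rmorphXn /= mmapX mmap1U -exprM.
  rewrite (_ : (k.+1 * 2 = k.+2 + k)%N); last by lia.
  by rewrite exprD (Xp _ _ _ Xx') -exprS subrr.
- by rewrite rmorphXn /= mmapX mmap1U => x0; rewrite -(Xp _ _ _ Xx) exprS x0 mulr0.
rewrite rmorphB rmorph1 rmorphXn /= mmapX mmap1U ci expr0n subr0 => /eqP.
by rewrite oner_eq0.
Qed.
End Ideals.

(** * Representations of the additive group *)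

(** A translation of the variable does not affect the coefficient of top degree. *)
Lemma coef_comp_XsubC (R : comNzRingType) (q : {poly R}) (c : R) d :
  (size q <= d.+1)%N -> (q \Po ('X - c%:P))`_d = q`_d.
Proof.
move=> sq; rewrite comp_polyE coef_sum.
have [ltd|led] := ltnP d (size q); last first.
  rewrite (nth_default _ led) big1 // => i _.
  rewrite coefZ [X in _ * X]nth_default ?mulr0 // size_exp_XsubC.
  by apply: leq_trans led; apply: ltn_ord.
rewrite (bigD1 (Ordinal ltd)) //= big1 ?addr0 => [|i nid]; last first.
  rewrite coefZ [X in _ * X]nth_default ?mulr0 // size_exp_XsubC.
  rewrite ltn_neqAle -ltnS (leq_trans (ltn_ord i) sq) andbT; exact: nid.
have := monicP (monic_exp d (monicXsubC c)).
by rewrite lead_coefE size_exp_XsubC coefZ => ->; rewrite mulr1.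
Qed.

Section AdditiveGroupRepresentations.
Variables (F : fieldType) (m : nat).

Definition eval_polymx (R : comNzRingType) (s : {rmorphism F -> R}) k
    (A : 'M[{poly F}]_(m, k)) (r : R) : 'M[R]_(m, k) :=
  map_mx (fun q => (map_poly s q).[r]) A.

Definition additive_rep (A : 'M[{poly F}]_m) : Prop :=
  forall (R : comNzRingType) (s : {rmorphism F -> R}),
    eval_polymx s A 0 = 1%:M /\
    forall r r', eval_polymx s A (r + r') = eval_polymx s A r *m eval_polymx s A r'.

Definition coef_mx (R : nzRingType) k l (d : nat) (A : 'M[{poly R}]_(k, l)) :
    'M[R]_(k, l) := map_mx (fun q : {poly R} => q`_d) A.

Lemma coef_mx_mul (R : comNzRingType) k l j d (A : 'M[R]_(k, l))
    (B : 'M[{poly R}]_(l, j)) :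
  coef_mx d (map_mx polyC A *m B) = A *m coef_mx d B.
Proof.
apply/matrixP=> a b; rewrite !mxE coef_sum; apply: eq_bigr => i _.
by rewrite !mxE coefCM.
Qed.

Lemma eval_polymxC (R : comNzRingType) (s : {rmorphism F -> R}) k
    (A : 'M[{poly F}]_(m, k)) r :
  eval_polymx (polyC \o s) A r%:P = map_mx polyC (eval_polymx s A r).
Proof.
by apply/matrixP=> i j; rewrite !mxE map_poly_comp /= horner_map.
Qed.

Lemma eval_polymxX (R : comNzRingType) (s : {rmorphism F -> R}) k
    (A : 'M[{poly F}]_(m, k)) :
  eval_polymx (polyC \o s) A 'X = map_mx (map_poly s) A.
Proof.
by apply/matrixP=> i j; rewrite !mxE map_poly_comp /= -/(_ \Po _) comp_polyXr.
Qed.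

(* The leading coefficient of A(Y) v is fixed: compare coefficients of top
   degree in Y in A(r + Y) v = A(r) A(Y) v. *)
Lemma additive_rep_fixed (A : 'M[{poly F}]_m) (v : 'cV[F]_m) :
  additive_rep A -> v != 0 ->
  exists d, let w := coef_mx d (A *m map_mx polyC v) in w != 0 /\
    forall (R : comNzRingType) (s : {rmorphism F -> R}) r,
      eval_polymx s A r *m map_mx s w = map_mx s w.
Proof.
move=> hA v0; have [g gE] : exists g, g = A *m map_mx polyC v by eexists.
rewrite -gE.
(* At 0 the vector A v specializes to v, because A(0) = 1. *)
have [i0 gi0] : exists i, g i 0 != 0.
  apply/existsP; apply: contraR v0 => /existsPn g0; apply/eqP.
  have [A0 _] := hA F idfun; rewrite -[v]mul1mx -A0.
  apply/matrixP=> i j; rewrite ord1 !mxE.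
  have /eqP := negbNE (g0 i); rewrite gE mxE => /(congr1 (horner^~ 0)).
  rewrite horner_sum horner0 => gi; rewrite -[RHS]gi.
  by apply: eq_bigr => k _; rewrite !mxE hornerM hornerC map_poly_id.
have [i1 _ maxi] := @arg_maxnP _ i0 xpredT (fun i => size (g i 0)) isT.
have gi1 : g i1 0 != 0.
  by rewrite -size_poly_gt0; apply: leq_trans (maxi i0 isT); rewrite size_poly_gt0.
exists (size (g i1 0)).-1 => w.
have szg i : (size (g i 0%R) <= (size (g i1 0%R)).-1.+1)%N.
  by rewrite prednK ?size_poly_gt0 //; apply: maxi.
split=> [|R s r].
  apply/eqP => /matrixP/(_ i1 0); rewrite mxE [RHS]mxE => /eqP.
  by rewrite -lead_coefE lead_coef_eq0 (negPf gi1).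
have [_ Ad] := hA {poly R} (polyC \o s).
have Ev t : eval_polymx (polyC \o s) A t *m map_mx (polyC \o s) v
    = eval_polymx (polyC \o s) g t.
  apply/matrixP=> i j; rewrite gE !mxE rmorph_sum horner_sum.
  apply: eq_bigr => k _; rewrite !mxE rmorphM hornerM /=.
  by rewrite map_polyC hornerC.
have sw : map_mx s w = coef_mx (size (g i1 0)).-1 (map_mx (map_poly s) g).
  by apply/matrixP=> i j; rewrite !mxE coef_map.
have := congr1 (fun B => coef_mx (size (g i1 0)).-1 (B *m map_mx (polyC \o s) v))
  (Ad r%:P 'X).
rewrite -mulmxA !Ev eval_polymxC coef_mx_mul eval_polymxX -sw => <-.
apply/matrixP=> i j; rewrite ord1 !mxE map_poly_comp /= addrC -/(_ \Po _).
rewrite -[r]opprK polyCN coef_comp_XsubC ?coef_map //.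
by apply: leq_trans (szg i); apply: size_poly.
Qed.

(** Let v1 be fixed by A. As A commutes with B, it fixes B(Y) v1 and hence each coefficient of it in
    Y; the leading one is also fixed by B. *)
Lemma commuting_additive_reps_fixed (A B : 'M[{poly F}]_m) (v : 'cV[F]_m) :
  additive_rep A -> additive_rep B ->
  (forall (R : comNzRingType) (s : {rmorphism F -> R}) r t,
     eval_polymx s A r *m eval_polymx s B t
     = eval_polymx s B t *m eval_polymx s A r) ->
  v != 0 ->
  exists w : 'cV[F]_m, w != 0 /\
    forall (R : comNzRingType) (s : {rmorphism F -> R}) r,
      eval_polymx s A r *m map_mx s w = map_mx s w /\
      eval_polymx s B r *m map_mx s w = map_mx s w.
Proof.
move=> hA hB AB /(additive_rep_fixed hA) [d0 /=]; move: (coef_mx _ _) => v1.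
move=> [v10 Av1]; have [d /= [w0 Bw]] := additive_rep_fixed hB v10.
exists (coef_mx d (B *m map_mx polyC v1)); split=> // R s r; split=> //.
have sw : map_mx s (coef_mx d (B *m map_mx polyC v1))
    = coef_mx d (eval_polymx (polyC \o s) B 'X *m map_mx (polyC \o s) v1).
  rewrite eval_polymxX; apply/matrixP=> i j; rewrite !mxE -coef_map rmorph_sum.
  by congr ((_ : {poly R})`_d); apply: eq_bigr => k _;
    rewrite !mxE rmorphM /= map_polyC.
by rewrite sw -coef_mx_mul -eval_polymxC mulmxA AB -mulmxA Av1.
Qed.
End AdditiveGroupRepresentations.

(** * Groups of points *)

Section Frobenius.
Variables (R : comNzRingType) (p : nat) (hp : p \in [pchar R]).
Implicit Types x y : R.

Lemma exprpD x y : (x + y) ^+ p = x ^+ p + y ^+ p.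
Proof. by rewrite -!(pFrobenius_autE hp) rmorphD. Qed.

Lemma exprpN x : (- x) ^+ p = - x ^+ p.
Proof. by rewrite -!(pFrobenius_autE hp) rmorphN. Qed.

Lemma pchar_gt0 : (0 < p)%N.
Proof. exact/prime_gt0/(pcharf_prime hp). Qed.

Lemma expr0p : 0 ^+ p = 0 :> R.
Proof. by rewrite expr0n gtn_eqF ?pchar_gt0. Qed.
End Frobenius.

Section GroupPointLaws.
Variables (F : fieldType) (G : groupScheme F).
Variables (R : comNzRingType) (s : {rmorphism F -> R}).
Implicit Types x y z : {ffun 'I_(gdim G) -> R}.

Lemma in_group1 : in_group s (one_pt G s).
Proof. by have [] := gclosedP G s. Qed.
Lemma in_groupV x : in_group s x -> in_group s (inv_pt s x).
Proof. by have [_ + _] := gclosedP G s; apply. Qed.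
Lemma in_groupM x y : in_group s x -> in_group s y -> in_group s (mul_pt s x y).
Proof. by have [_ _] := gclosedP G s; apply. Qed.
Lemma mul_ptA x y z : in_group s x -> in_group s y -> in_group s z ->
  mul_pt s x (mul_pt s y z) = mul_pt s (mul_pt s x y) z.
Proof. by have [+ _ _] := gaxiomsP G s; apply. Qed.
Lemma mul1pt x : in_group s x -> mul_pt s (one_pt G s) x = x.
Proof. by have [_ + _] := gaxiomsP G s; apply. Qed.
Lemma mulVpt x : in_group s x -> mul_pt s (inv_pt s x) x = one_pt G s.
Proof. by have [_ _] := gaxiomsP G s; apply. Qed.

Lemma mulptV x : in_group s x -> mul_pt s x (inv_pt s x) = one_pt G s.
Proof.
move=> Gx; have Gy := in_groupV Gx; have Gz := in_groupV Gy.
set y := inv_pt s x in Gy Gz *; have Gxy := in_groupM Gx Gy.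
rewrite -[LHS]mul1pt // -{1}(mulVpt Gy) -mul_ptA //.
by rewrite (mul_ptA Gy) // [mul_pt s y x]mulVpt // mul1pt // mulVpt.
Qed.

Lemma mulpt1 x : in_group s x -> mul_pt s x (one_pt G s) = x.
Proof.
move=> Gx; rewrite -(mulVpt Gx) mul_ptA ?mulptV ?mul1pt //; exact: in_groupV.
Qed.
End GroupPointLaws.

Lemma map_pt_comp (F : fieldType) (R : comNzRingType) (s : {rmorphism F -> R})
    k l n (psi : {ffun 'I_n -> {mpoly F[l]}}) (phi : {ffun 'I_l -> {mpoly F[k]}})
    (x : {ffun 'I_k -> R}) :
  map_pt s [ffun i => mmap (@mpolyC _ F) phi (psi i)] x
  = map_pt s psi (map_pt s phi x).
Proof.
apply/ffunP=> i; rewrite !ffunE rmorph_mmap /=.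
by apply: eq_mmap => j /=; rewrite ?mmapC ?ffunE.
Qed.

Definition id_map (F : fieldType) n : {ffun 'I_n -> {mpoly F[n]}} :=
  [ffun i => 'X_i].

Lemma map_pt_id (F : fieldType) (R : comNzRingType) (s : {rmorphism F -> R}) n
    (x : {ffun 'I_n -> R}) : map_pt s (id_map F n) x = x.
Proof. by apply/ffunP=> i; rewrite !ffunE mmapX mmap1U. Qed.

(** * Quotients split by a retraction *)

Section Retraction.
Variables (F : fieldType) (G : groupScheme F) (M U : subgroupScheme G).
Variable pi : group_hom_data G (group_of_sub M).
Hypothesis pi_hom : is_group_hom pi.
Hypothesis pi_id : forall (R : comNzRingType) (s : {rmorphism F -> R}) x,
  in_subgroup M s x -> map_pt s pi x = x.
Hypothesis pi_ker : forall (R : comNzRingType) (s : {rmorphism F -> R}) x,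
  in_group s x -> (map_pt s pi x = one_pt G s <-> in_subgroup U s x).

(** Every x is n pi(x) with n = x pi(x)^-1 in U, so a homomorphism trivial on U is determined by its
    restriction to M. The factorization is this restriction, given by the same polynomials. *)
Lemma retraction_quotient : is_quotient U pi.
Proof.
split=> // H phi phi_hom phi_triv.
have subM (R : comNzRingType) (s : {rmorphism F -> R}) x :
    in_subgroup M s x -> in_group s x by apply: seqs_sub.
have phi_pi (R : comNzRingType) (s : {rmorphism F -> R}) x : in_group s x ->
    map_pt s phi (map_pt s pi x) = map_pt s phi x.
  move=> Gx; have [piG piM] := pi_hom s; have [phiG phiM] := phi_hom R s.
  have Mg : in_subgroup M s (map_pt s pi x) := piG _ Gx.
  have [_ MV _] := @sclosedP _ _ M R s; have Mg' := MV _ Mg.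
  have Gg := subM _ _ _ Mg; have Gg' := subM _ _ _ Mg'.
  pose n := mul_pt s x (inv_pt s (map_pt s pi x)).
  have Un : in_subgroup U s n.
    apply/pi_ker; first exact: in_groupM.
    by rewrite piM // [X in mul_pt s _ X]pi_id //; apply: (mulptV Gg).
  have xE : x = mul_pt s n (map_pt s pi x).
    by rewrite /n -mul_ptA // mulVpt // mulpt1.
  rewrite [in RHS]xE phiM //; last exact: in_groupM.
  by rewrite (phi_triv _ _ _ Un) mul1pt //; apply: phiG.
exists phi; split=> [R s|R s x Gx|psi _ psi_pi R s x Mx].
- have [phiG phiM] := phi_hom R s.
  by split=> [x /subM/phiG|x y /subM Gx /subM Gy] //; apply: phiM.
- by rewrite /comp_hom map_pt_comp phi_pi.
- have := psi_pi R s x (subM _ _ _ Mx).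
  by rewrite /comp_hom map_pt_comp [map_pt s pi x]pi_id.
Qed.

Lemma retraction_restricts_to_iso : restricts_to_iso M pi.
Proof.
exists (id_map F (gdim G)); split=> [R s|R s].
  split=> [x Mx|x y _ _]; rewrite !map_pt_id //.
  by apply: (@seqs_sub _ _ M).
split=> [y|y /pi_id + |x Mx]; rewrite map_pt_id //.
exact: pi_id.
Qed.
End Retraction.

(** * The twisted extension of (Z/p)^2 by G_a^2 *)

(** Ordinals with closed proofs, so that the coordinates of [pt4] compute. *)
Definition o0 : 'I_4 := Ordinal (isT : (0 < 4)%N).
Definition o1 : 'I_4 := Ordinal (isT : (1 < 4)%N).
Definition o2 : 'I_4 := Ordinal (isT : (2 < 4)%N).
Definition o3 : 'I_4 := Ordinal (isT : (3 < 4)%N).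

Lemma forall_I4 (P : 'I_4 -> Prop) : P o0 -> P o1 -> P o2 -> P o3 -> forall i, P i.
Proof.
move=> P0 P1 P2 P3 [[|[|[|[|i]]]] lt_i] //;
  by rewrite (bool_irrelevance lt_i isT).
Qed.

Definition pt4 (T : Type) (u z a b : T) : {ffun 'I_4 -> T} :=
  [ffun i => tnth [tuple u; z; a; b] i].

Section Pt4.
Variables (T : Type) (u z a b : T).
Lemma pt4_0 : pt4 u z a b o0 = u. Proof. by rewrite ffunE. Qed.
Lemma pt4_1 : pt4 u z a b o1 = z. Proof. by rewrite ffunE. Qed.
Lemma pt4_2 : pt4 u z a b o2 = a. Proof. by rewrite ffunE. Qed.
Lemma pt4_3 : pt4 u z a b o3 = b. Proof. by rewrite ffunE. Qed.
Definition pt4E := (pt4_0, pt4_1, pt4_2, pt4_3).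
Lemma eq_pt4 (x : {ffun 'I_4 -> T}) :
  x o0 = u -> x o1 = z -> x o2 = a -> x o3 = b -> x = pt4 u z a b.
Proof. by move=> *; apply/ffunP; apply: forall_I4; rewrite pt4E. Qed.
End Pt4.

Lemma map_pt4 (F : fieldType) (R : comNzRingType) (s : {rmorphism F -> R}) n
    (q0 q1 q2 q3 : {mpoly F[n]}) (x : {ffun 'I_n -> R}) :
  map_pt s (pt4 q0 q1 q2 q3) x
  = pt4 (mmap s x q0) (mmap s x q1) (mmap s x q2) (mmap s x q3).
Proof. by apply: eq_pt4; rewrite !ffunE. Qed.

Section Law.
Variables (R : comNzRingType) (p : nat) (c : R).
Implicit Types x y z : {ffun 'I_4 -> R}.

(** The term u^p - u comes from the action of b and [c] a from the commutator of the generators. In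
    characteristic p the sum is additive in [y], which gives associativity of [tw_mul]. *)
Definition tw_cocycle y : R := y o0 ^+ p - y o0 + c * y o2.
Definition tw_mul x y := pt4 (x o0 + y o0) (x o1 + y o1 + x o3 * tw_cocycle y)
  (x o2 + y o2) (x o3 + y o3).
Definition tw_inv x := pt4 (- x o0) (- x o1 + x o3 * tw_cocycle x)
  (- x o2) (- x o3).
Definition tw_one : {ffun 'I_4 -> R} := pt4 0 0 0 0.

Hypothesis hp : p \in [pchar R].

Lemma tw_mulA x y z : tw_mul x (tw_mul y z) = tw_mul (tw_mul x y) z.
Proof.
rewrite /tw_mul /tw_cocycle !pt4E (exprpD hp).
by congr pt4; ring.
Qed.

Lemma tw_mul1 x : tw_mul tw_one x = x.
Proof. by symmetry; apply: eq_pt4; rewrite !pt4E; ring. Qed.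

Lemma tw_mulV x : tw_mul (tw_inv x) x = tw_one.
Proof. by rewrite /tw_mul !pt4E; congr pt4; ring. Qed.
End Law.

(* Points of the group with coordinates (u, z, a, b): an extension of (Z/p)^2,
   with coordinates (a, b), by G_a^2, with coordinates (u, z), in which b acts
   on u by u |-> u + b (u^p - u) and the lifts (0, 0, 1, 0) and (0, 0, 0, 1) of
   the generators have commutator f. *)
Definition is_tw_group (E : fieldType) (p : nat) (f : E)
    (X : seq {mpoly E[4]}) (mul : {ffun 'I_4 -> {mpoly E[4 + 4]}})
    (inv : {ffun 'I_4 -> {mpoly E[4]}}) (one : {ffun 'I_4 -> E}) : Prop :=
  forall (R : comNzRingType) (s : {rmorphism E -> R}),
  [/\ forall x, on_scheme s X x <-> x o2 ^+ p = x o2 /\ x o3 ^+ p = x o3,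
      forall x y, map_pt s mul (pair_pt x y) = tw_mul p (s f) x y,
      forall x, map_pt s inv x = tw_inv p (s f) x
    & const_pt s one = tw_one R].

(** A description by points passes to any extension field, so what is proved from [is_tw_group]
    applies both to the group and to its base changes, whose equations and laws are only equal on
    points to those built over [E]. *)
Lemma is_tw_group_bc (F E : fieldType) (iota : {rmorphism F -> E}) p f X mul inv one :
  is_tw_group p f X mul inv one ->
  is_tw_group p (iota f) (bc_eqs iota X) (bc_map iota mul) (bc_map iota inv)
    (bc_const iota one).
Proof.
move=> h R s; have [h1 h2 h3 h4] := h R (s \o iota).
split=> [x|x y|x|]; rewrite ?on_scheme_bc ?map_pt_bc ?const_pt_bc //.
Qed.

Section Construction.
Variables (F : fieldType) (p : nat) (hp : p \in [pchar F]) (f : F).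

Definition tw_eqs : seq {mpoly F[4]} := [:: 'X_o2 ^+ p - 'X_o2; 'X_o3 ^+ p - 'X_o3].
(** The law on points, evaluated at the coordinate functions of a pair of generic points. *)
Definition tw_gmul : {ffun 'I_4 -> {mpoly F[4 + 4]}} :=
  tw_mul p f%:MP [ffun i => 'X_(lshift 4 i)] [ffun i => 'X_(rshift 4 i)].
Definition tw_ginv : {ffun 'I_4 -> {mpoly F[4]}} := tw_inv p f%:MP (id_map F 4).

Lemma tw_gE : is_tw_group p f tw_eqs tw_gmul tw_ginv (tw_one F).
Proof.
move=> R s; split=> [x|x y|x|].
- split=> [h|[h2 h3] q].
    split; apply/eqP; rewrite -subr_eq0.
      by have /h := mem_head ('X_o2 ^+ p - 'X_o2)
        [:: 'X_o3 ^+ p - 'X_o3 : {mpoly F[4]}];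
        rewrite rmorphB rmorphXn /= mmapX mmap1U => ->.
    by have /h := mem_last ('X_o2 ^+ p - 'X_o2)
        [:: 'X_o3 ^+ p - 'X_o3 : {mpoly F[4]}];
        rewrite rmorphB rmorphXn /= mmapX mmap1U => ->.
  rewrite !inE => /orP[]/eqP->; rewrite rmorphB rmorphXn /= mmapX mmap1U;
    by rewrite ?h2 ?h3 subrr.
- have xE i : pair_pt x y (lshift 4 i) = x i.
    by rewrite ffunE (unsplitK (inl i)).
  have yE i : pair_pt x y (rshift 4 i) = y i.
    by rewrite ffunE (unsplitK (inr i)).
  rewrite /tw_gmul /tw_mul map_pt4 /tw_cocycle !(ffunE (fun=> 'X_ _)).
  by rewrite !(rmorphD, rmorphN, rmorphM, rmorphXn) /= !mmapX !mmap1U !mmapC !xE !yE.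
- rewrite /tw_ginv /tw_inv map_pt4 /tw_cocycle !(ffunE (fun=> 'X_ _)).
  by rewrite !(rmorphD, rmorphN, rmorphM, rmorphXn) /= !mmapX !mmap1U !mmapC.
- by rewrite /tw_one; apply: eq_pt4; rewrite ffunE pt4E rmorph0.
Qed.

Lemma tw_closed (R : comNzRingType) (s : {rmorphism F -> R}) :
  closed_under_group_laws tw_eqs tw_gmul tw_ginv (tw_one F) s.
Proof.
have [XE mulE invE oneE] := tw_gE s; have hR := rmorph_pchar s hp.
split=> [|x /XE[x2 x3]|x y /XE[x2 x3] /XE[y2 y3]]; apply/XE.
- by rewrite oneE !pt4E (expr0p hR).
- by rewrite invE !pt4E !(exprpN hR) x2 x3.
- by rewrite mulE !pt4E !(exprpD hR) x2 x3 y2 y3.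
Qed.

Lemma tw_axioms (R : comNzRingType) (s : {rmorphism F -> R}) :
  satisfies_group_axioms tw_eqs tw_gmul tw_ginv (tw_one F) s.
Proof.
have [XE mulE invE oneE] := tw_gE s; have hR := rmorph_pchar s hp.
split=> [x y z _ _ _|x _|x _].
- by rewrite !mulE tw_mulA.
- by rewrite mulE oneE tw_mul1.
- by rewrite invE mulE oneE tw_mulV.
Qed.

Definition tw_group : groupScheme F := GroupScheme tw_closed tw_axioms.
End Construction.

(** * The plane a = b = 0, later the unipotent radical *)

Section CoordinatePlane.
Variable E : fieldType.
Definition plane_eqs : seq {mpoly E[4]} := [:: 'X_o2; 'X_o3].

Lemma on_plane (R : comNzRingType) (s : {rmorphism E -> R}) x :
  on_scheme s plane_eqs x <-> x o2 = 0 /\ x o3 = 0.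
Proof.
split=> [h|[x2 x3] q].
  have /h := mem_head 'X_o2 [:: 'X_o3 : {mpoly E[4]}].
  have /h := mem_last 'X_o2 [:: 'X_o3 : {mpoly E[4]}].
  by rewrite !mmapX !mmap1U.
by rewrite !inE => /orP[]/eqP->; rewrite mmapX mmap1U.
Qed.

Lemma plane_smooth : scheme_smooth plane_eqs.
Proof.
move=> R R' s q q_surj _ x' /on_plane[x'2 x'3].
have [a qa] := q_surj (x' o0); have [b qb] := q_surj (x' o1).
exists (pt4 a b 0 0); split; first by apply/on_plane; rewrite !pt4E.
apply/ffunP; apply: forall_I4; rewrite ffunE pt4E ?rmorph0 //.
Qed.

Definition plane_proj : {ffun 'I_4 -> {mpoly E[4]}} := pt4 'X_o0 'X_o1 0 0.

Lemma plane_projP q :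
  in_ideal plane_eqs (q - mmap (@mpolyC 4 E) plane_proj q).
Proof.
elim/mpoly_ring_ind: q => [c|i|q r Hq Hr|q r Hq Hr].
- by rewrite mmapC subrr; apply: in_ideal0.
- rewrite mmapX mmap1U; move: i; apply: forall_I4;
    rewrite pt4E ?subrr ?subr0; try exact: in_ideal0;
    by apply: mem_in_ideal; rewrite !inE eqxx ?orbT.
- by rewrite rmorphD opprD addrACA; apply: in_idealD.
rewrite rmorphM /=; set q' := mmap _ _ q; set r' := mmap _ _ r.
rewrite (_ : _ - _ = r * (q - q') + q' * (r - r')); last by ring.
by apply: in_idealMD => //; apply: in_idealM.
Qed.

(** By [plane_projP] a polynomial is determined modulo the ideal by its image under [plane_proj],
    which is itself a point of the plane over a polynomial ring. That ring is a domain, so the image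
    of an idempotent is 0 or 1. *)
Lemma plane_connected : scheme_connected plane_eqs.
Proof.
have on0 : on_scheme idfun plane_eqs (tw_one E) by apply/on_plane; rewrite !pt4E.
split=> [/(in_ideal_vanish on0)/eqP|e]; first by rewrite rmorph1 oner_eq0.
have onP : on_scheme (@mpolyC 4 E) plane_eqs plane_proj.
  by apply/on_plane; rewrite !pt4E.
move=> /(in_ideal_vanish onP); rewrite rmorphB rmorphXn /=.
have := plane_projP e; set e' := mmap _ _ e => he.
move=> /eqP; rewrite expr2 -{3}[e']mulr1 -mulrBr mulf_eq0 subr_eq0.
case/orP=> /eqP e'E; move: he; rewrite e'E ?subr0; first by left.
by move=> /(in_idealM (-1)); rewrite mulN1r opprB; right.
Qed.
End CoordinatePlane.

Section Structure.
Variables (E : fieldType) (p : nat) (hp : p \in [pchar E]) (f : E).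
Variables (X : seq {mpoly E[4]}) (mul : {ffun 'I_4 -> {mpoly E[4 + 4]}}).
Variables (inv : {ffun 'I_4 -> {mpoly E[4]}}) (one : {ffun 'I_4 -> E}).
Variables (cl : forall (R : comNzRingType) (s : {rmorphism E -> R}),
  closed_under_group_laws X mul inv one s).
Variables (ax : forall (R : comNzRingType) (s : {rmorphism E -> R}),
  satisfies_group_axioms X mul inv one s).
Hypothesis tw : is_tw_group p f X mul inv one.
Let G : groupScheme E := GroupScheme cl ax.

Lemma in_twP (R : comNzRingType) (s : {rmorphism E -> R}) x :
  in_group (G := G) s x <-> x o2 ^+ p = x o2 /\ x o3 ^+ p = x o3.
Proof. by have [XE _ _ _] := tw s; apply: XE. Qed.

Lemma tw_mul_ptE (R : comNzRingType) (s : {rmorphism E -> R}) x y :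
  mul_pt (G := G) s x y = tw_mul p (s f) x y.
Proof. by have [_ mulE _ _] := tw s; apply: mulE. Qed.

Lemma tw_inv_ptE (R : comNzRingType) (s : {rmorphism E -> R}) x :
  inv_pt (G := G) s x = tw_inv p (s f) x.
Proof. by have [_ _ invE _] := tw s; apply: invE. Qed.

Lemma tw_one_ptE (R : comNzRingType) (s : {rmorphism E -> R}) :
  one_pt G s = tw_one R.
Proof. by have [_ _ _ oneE] := tw s; apply: oneE. Qed.

Lemma tw_smooth : is_linear_algebraic_group G.
Proof.
move=> R R' s q q_surj q_sq0 x' /(in_twP (q \o s)) [x'2 x'3].
(* Newton's method for a^p = a, whose derivative is -1. *)
have lift a' : a' ^+ p = a' -> exists2 a, a ^+ p = a & q a = a'.
  have [a <-] := q_surj a' => /eqP; rewrite -rmorphXn -subr_eq0 -rmorphB => /eqP h.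
  have hR := rmorph_pchar s hp; have p_pr := pcharf_prime hp.
  (* One Newton step from a gives a - (a^p - a) / (-1) = a^p. It is an exact solution: (a^p)^p - a^p
     is the p-th power of the square-zero error a^p - a. *)
  exists (a ^+ p); last by apply/eqP; rewrite -subr_eq0 -rmorphB h.
  have /eqP := q_sq0 _ _ h h; rewrite -expr2 => /eqP sq0.
  apply/eqP; rewrite -subr_eq0 -(exprpN hR) -(exprpD hR).
  have nil y : y ^+ 2 = 0 -> y ^+ p = 0 :> R.
    by move=> y0; rewrite -(subnK (prime_gt1 p_pr)) exprD y0 mulr0.
  exact/eqP/nil.
have [u qu] := q_surj (x' o0); have [z qz] := q_surj (x' o1).
have [a ap qa] := lift _ x'2; have [b bp qb] := lift _ x'3.
exists (pt4 u z a b); split; first by apply/in_twP; rewrite !pt4E.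
by apply/ffunP; apply: forall_I4; rewrite ffunE pt4E.
Qed.

Lemma plane_sub (R : comNzRingType) (s : {rmorphism E -> R}) x :
  on_scheme s (plane_eqs E) x -> in_group (G := G) s x.
Proof.
by move/on_plane=> [x2 x3]; apply/in_twP; rewrite x2 x3 (expr0p (rmorph_pchar s hp)).
Qed.

Lemma plane_closed (R : comNzRingType) (s : {rmorphism E -> R}) :
  closed_under_group_laws (plane_eqs E) (gmul G) (ginv G) (gone G) s.
Proof.
have [_ mulE invE oneE] := tw s.
split=> [|x /on_plane[x2 x3]|x y /on_plane[x2 x3] /on_plane[y2 y3]]; apply/on_plane.
- by rewrite oneE !pt4E.
- by rewrite invE !pt4E x2 x3 oppr0.
- by rewrite mulE !pt4E x2 x3 y2 y3 addr0.
Qed.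

Definition tw_radical : subgroupScheme G :=
  @SubgroupScheme E G (plane_eqs E) plane_sub plane_closed.

Section Radical.
Variables (U : subgroupScheme G) (UE : seqs U = plane_eqs E).

(** Only the equations of [U] are fixed, so that the section also applies to the base change of
    [tw_radical], whose equations become [plane_eqs] after rewriting. *)
Lemma in_radicalP (R : comNzRingType) (s : {rmorphism E -> R}) x :
  in_subgroup U s x <-> x o2 = 0 /\ x o3 = 0.
Proof. by rewrite /in_subgroup UE; apply: on_plane. Qed.

(** The two axes of the plane are commuting copies of G_a with (u, z) = (u, 0)(0, z). The
    representation restricts to [A] and [B] on them, and a common fixed vector is fixed by the whole
    plane. *)
Lemma radical_unipotent : unipotent (group_of_sub U).
Proof.
move=> m rho rho_rep.
have UP (R : comNzRingType) (s : {rmorphism E -> R}) u z :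
  in_group (G := group_of_sub U) s (pt4 u z 0 0) by apply/in_radicalP; rewrite !pt4E.
have UM (R : comNzRingType) (s : {rmorphism E -> R}) u z u' z' :
    map_mx (mmap s (pt4 (u + u') (z + z') 0 0)) rho =
    map_mx (mmap s (pt4 u z 0 0)) rho *m map_mx (mmap s (pt4 u' z' 0 0)) rho.
  have [_ <- //] := rho_rep _ s; rewrite [mul_pt _ _ _](tw_mul_ptE s).
  by rewrite /tw_mul !pt4E mul0r !addr0.
have U1 (R : comNzRingType) (s : {rmorphism E -> R}) :
    map_mx (mmap s (pt4 0 0 0 0)) rho = 1%:M.
  by have [<- _] := rho_rep _ s; rewrite [one_pt _ _](tw_one_ptE s).
pose A : 'M[{poly E}]_m.+1 := map_mx (mmap polyC (pt4 'X 0 0 0)) rho.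
pose B : 'M[{poly E}]_m.+1 := map_mx (mmap polyC (pt4 0 'X 0 0)) rho.
have evE (R : comNzRingType) (s : {rmorphism E -> R}) r q u z :
    (map_poly s (mmap polyC (pt4 u z 0 0) q)).[r]
    = mmap s (pt4 (map_poly s u).[r] (map_poly s z).[r] 0 0) q.
  rewrite -[LHS]/((horner_eval r \o map_poly s) _) rmorph_mmap.
  apply: eq_mmap => [c|] /=; first by rewrite map_polyC /= horner_evalE hornerC.
  apply: forall_I4; rewrite /= !pt4E //; by rewrite horner_evalE rmorph0 horner0.
have AE (R : comNzRingType) (s : {rmorphism E -> R}) r :
    eval_polymx s A r = map_mx (mmap s (pt4 r 0 0 0)) rho.
  by apply/matrixP=> i j; rewrite !mxE evE map_polyX hornerX rmorph0 horner0.
have BE (R : comNzRingType) (s : {rmorphism E -> R}) r :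
    eval_polymx s B r = map_mx (mmap s (pt4 0 r 0 0)) rho.
  by apply/matrixP=> i j; rewrite !mxE evE map_polyX hornerX rmorph0 horner0.
have [||||w [w0 ABw]] := @commuting_additive_reps_fixed E m.+1 A B (const_mx 1).
- by move=> R s; split=> [|r r']; rewrite !AE ?U1 // -UM addr0.
- by move=> R s; split=> [|r r']; rewrite !BE ?U1 // -UM addr0.
- by move=> R s r t; rewrite AE BE -!UM !addr0 !add0r.
- by apply/eqP => /matrixP/(_ 0 0)/eqP; rewrite !mxE oner_eq0.
exists w; split=> // R s x /in_radicalP[x2 x3].
have -> : x = pt4 (x o0 + 0) (0 + x o1) 0 0 by rewrite add0r addr0; apply: eq_pt4.
rewrite UM -AE -BE -mulmxA.
by have [_ ->] := ABw R s (x o1); have [-> _] := ABw R s (x o0).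
Qed.

Lemma radical_normal : sub_normal U.
Proof.
move=> R s g x _ /in_radicalP[x2 x3]; apply/in_radicalP.
by rewrite tw_inv_ptE !tw_mul_ptE !pt4E x2 x3 !addr0 !subrr.
Qed.

(** On a connected subgroup the coordinates a and b solve x^p = x and vanish at the identity, so
    they vanish everywhere. *)
Lemma radical_largest : is_largest_sm_conn_normal_unip U.
Proof.
split.
  split; rewrite ?UE; [exact: plane_smooth | exact: plane_connected | |].
    exact: radical_normal.
  exact: radical_unipotent.
move=> N [_ Nconn _ _] R s x Nx.
have p_pr := pcharf_prime hp.
have NG (R' : comNzRingType) (s' : {rmorphism E -> R'}) y
  (hy : on_scheme s' (seqs N) y) :=
  seqs_sub hy.
have N1 : on_scheme idfun (seqs N) (tw_one E).
  have [+ _ _] := sclosedP N (idfun : {rmorphism E -> E}).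
  by have := tw_one_ptE (idfun : {rmorphism E -> E}); rewrite /one_pt => ->.
by apply/in_radicalP; split;
  apply: (connected_coord0 p_pr Nconn _ N1 _ Nx); rewrite ?pt4E // =>
    R' s' y /NG/in_twP[].
Qed.
End Radical.
End Structure.

(** * Levi factors of the twisted extension *)

Section Levi.
Variables (E : fieldType) (p : nat) (hp : p \in [pchar E]) (f : E).
Variables (X : seq {mpoly E[4]}) (mul : {ffun 'I_4 -> {mpoly E[4 + 4]}}).
Variables (inv : {ffun 'I_4 -> {mpoly E[4]}}) (one : {ffun 'I_4 -> E}).
Variables (cl : forall (R : comNzRingType) (s : {rmorphism E -> R}),
  closed_under_group_laws X mul inv one s).
Variables (ax : forall (R : comNzRingType) (s : {rmorphism E -> R}),
  satisfies_group_axioms X mul inv one s).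
Hypothesis tw : is_tw_group p f X mul inv one.
Let G : groupScheme E := GroupScheme cl ax.
Let U : subgroupScheme G := tw_radical hp cl ax tw.

Lemma tw_unipotent_radical : is_unipotent_radical U.
Proof.
split=> [|L iota _]; first exact: (radical_largest hp tw).
apply: (radical_largest (rmorph_pchar iota hp) (is_tw_group_bc iota tw)).
by rewrite /= /bc_eqs /plane_eqs /= !map_mpolyX.
Qed.

(** A Levi factor is given with a radical of its own; two largest subgroups contain each other, so
    that radical is the plane. *)
Lemma radical_unique (U' : subgroupScheme G) :
  is_unipotent_radical U' ->
  forall (R : comNzRingType) (s : {rmorphism E -> R}) x,
    in_subgroup U' s x <-> x o2 = 0 /\ x o3 = 0.
Proof.
case=> [[U'scnu U'max] _] R s x; rewrite -(in_radicalP (U := U)) //.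
have [[Uscnu Umax] _] := tw_unipotent_radical.
by split; [apply: Umax | apply: U'max].
Qed.

(* The images of (0, 0, 1, 0) and (0, 0, 0, 1) under the section of G -> Q are
   (u, z, 1, 0) and (u', z', 0, 1) with trivial commutator f + (u^p - u). *)
Lemma levi_artin_schreier : has_levi_factor G -> exists y, y ^+ p - y = f.
Proof.
move=> [M [_ [U' [Q [pi [U'rad [pi_hom pi_ker _] [sigma [sigma_hom sigmaP]]]]]]]].
have U'E := radical_unique U'rad.
pose s : {rmorphism E -> E} := idfun.
have [piG piM] := pi_hom E s; have [sG sM] := sigma_hom E s.
have [sigM pi_sig _] := sigmaP E s.
have triv n g : in_subgroup U' s n -> in_group (G := G) s g ->
    map_pt s pi (mul_pt (G := G) s n g) = map_pt s pi g.
  move=> Un Gg; have Gn : in_group (G := G) s n by apply: (seqs_sub Un).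
  rewrite piM // (proj2 (pi_ker E s n Gn) Un) mul1pt //; exact: piG.
(* An endomorphism of the group of [E]-points that is constant on cosets of the radical and, by
   [liftE], preserves a and b. *)
pose lift g := map_pt s sigma (map_pt s pi g).
have liftG g : in_group (G := G) s g -> in_group (G := G) s (lift g).
  by move/piG/sG.
have liftM g h : in_group (G := G) s g -> in_group (G := G) s h ->
    lift (mul_pt (G := G) s g h) = mul_pt (G := G) s (lift g) (lift h).
  by move=> Gg Gh; rewrite /lift piM // sM //; apply: piG.
have liftE g : in_group (G := G) s g -> lift g o2 = g o2 /\ lift g o3 = g o3.
  move=> Gg; have Gg' := in_groupV Gg.
  have Glg := liftG _ Gg; have Gn := in_groupM Glg Gg'.
  have /U'E : in_subgroup U' s (mul_pt (G := G) s (lift g) (inv_pt s g)).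
    apply/pi_ker => //; rewrite piM // /lift pi_sig; last exact: piG.
    rewrite -piM // mulptV //; apply/pi_ker; first exact: in_group1.
    by have [] := @sclosedP _ _ U' E s.
  rewrite (tw_inv_ptE tw) (tw_mul_ptE tw) !pt4E.
  by case=> /eqP + /eqP; rewrite !subr_eq0 => /eqP-> /eqP->.
pose g2 : {ffun 'I_4 -> E} := pt4 0 0 1 0.
pose g3 : {ffun 'I_4 -> E} := pt4 0 0 0 1.
have G2 : in_group (G := G) s g2.
  by apply/(in_twP tw); rewrite !pt4E expr1n (expr0p hp).
have G3 : in_group (G := G) s g3.
  by apply/(in_twP tw); rewrite !pt4E expr1n (expr0p hp).
have Un : in_subgroup U' s (pt4 0 f 0 0) by apply/U'E; rewrite !pt4E.
have comm : mul_pt (G := G) s g3 g2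
    = mul_pt (G := G) s (pt4 0 f 0 0) (mul_pt (G := G) s g2 g3).
  rewrite !(tw_mul_ptE tw) /tw_mul /tw_cocycle !pt4E !addr0 (expr0p hp) -[s f]/f.
  by congr pt4; ring.
have := liftM _ _ G3 G2; rewrite comm {1}/lift triv -?/(lift _);
  [|by []|exact: in_groupM].
rewrite liftM // !(tw_mul_ptE tw) => /(congr1 (fun x : {ffun _} => x o1)).
have [l22 l23] := liftE _ G2; have [l32 l33] := liftE _ G3.
rewrite /tw_mul /tw_cocycle !pt4E l22 l23 l32 l33 !pt4E -[s f]/f => /eqP h.
(* The coordinate u of the lift satisfies u^p - u = -f. *)
exists (- lift g2 o0); rewrite (exprpN hp).
move: h; rewrite -subr_eq0 => /eqP h.
move: (lift g2 o0 ^+ p) h => v h; apply/eqP; rewrite -subr_eq0 -[X in _ == X]h.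
by apply/eqP; rewrite mul0r mul1r mulr1; ring.
Qed.

(** The Levi factor is the graph u = -y a, z = 0. On it a^p = a gives u^p - u + f a = -(y^p - y) a +
    f a = 0, so the twisting term vanishes and the law is plain addition. *)
Lemma artin_schreier_levi y : y ^+ p - y = f -> has_levi_factor G.
Proof.
move=> yE.
pose eqsM : seq {mpoly E[4]} := 'X_o0 + y *: 'X_o2 :: 'X_o1 :: X.
have onM (R : comNzRingType) (s : {rmorphism E -> R}) x : on_scheme s eqsM x <->
    [/\ x o0 = - (s y * x o2), x o1 = 0, x o2 ^+ p = x o2 & x o3 ^+ p = x o3].
  have q0 : mmap s x ('X_o0 + y *: 'X_o2) = x o0 + s y * x o2.
    by rewrite mmapD mmapZ !mmapX !mmap1U.
  have q1 : mmap s x 'X_o1 = x o1 by rewrite mmapX mmap1U.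
  have [XE _ _ _] := tw s; split=> [h|[x0 x1 x2 x3] q].
    have /XE[x2 x3] : on_scheme s X x.
      by move=> q qX; apply: h; rewrite !inE qX !orbT.
    split=> //; last by rewrite -q1; apply: h; rewrite !inE eqxx orbT.
    by apply/eqP; rewrite -addr_eq0 -q0 h // inE eqxx.
  rewrite !inE => /or3P[/eqP->|/eqP->|qX]; [|by rewrite q1|].
    by rewrite q0 x0 addNr.
  by move: qX; apply/(proj2 (XE x)).
have subM (R : comNzRingType) (s : {rmorphism E -> R}) x :
    on_scheme s eqsM x -> in_group (G := G) s x.
  by move/onM=> [_ _ x2 x3]; apply/(in_twP tw).
have coc (R : comNzRingType) (s : {rmorphism E -> R}) (x : {ffun 'I_4 -> R}) :
    x o0 = - (s y * x o2) -> x o2 ^+ p = x o2 -> tw_cocycle p (s f) x = 0.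
  move=> x0 x2; have hR := rmorph_pchar s hp.
  rewrite /tw_cocycle x0 (exprpN hR) exprMn x2 -yE rmorphB rmorphXn /=; ring.
have clM (R : comNzRingType) (s : {rmorphism E -> R}) :
    closed_under_group_laws eqsM (gmul G) (ginv G) (gone G) s.
  have [_ mulE invE oneE] := tw s; have hR := rmorph_pchar s hp.
  split=> [|x /onM[x0 x1 x2 x3]|x x' /onM[x0 x1 x2 x3] /onM[x'0 x'1 x'2 x'3]];
    apply/onM.
  - by rewrite oneE !pt4E mulr0 oppr0 (expr0p hR).
  - by rewrite invE !pt4E (coc _ _ _ x0) // x0 x1 !(exprpN hR) x2 x3 mulr0 addr0
      oppr0; split=> //; rewrite mulrN.
  - rewrite mulE !pt4E (coc _ _ _ x'0) // x0 x1 x'0 x'1 !(exprpD hR) x2 x3 x'2 x'3.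
    by rewrite mulr0 !addr0; split=> //; ring.
pose M : subgroupScheme G := @SubgroupScheme E G eqsM subM clM.
pose pi : group_hom_data G (group_of_sub M) := pt4 (- (y *: 'X_o2)) 0 'X_o2 'X_o3.
have piE (R : comNzRingType) (s : {rmorphism E -> R}) x :
    map_pt s pi x = pt4 (- (s y * x o2)) 0 (x o2) (x o3).
  by rewrite [LHS]map_pt4 mmapN mmapZ mmap0 !mmapX !mmap1U.
exists M; split.
  (* Smoothness of [G] provides a lift; [pi] moves it into the graph, and it still lifts x' since
     [pi] fixes the points of the graph. *)
  move=> R R' s q q_surj q_sq0 x' /(onM _ (q \o s)) [x'0 x'1 x'2 x'3].
  have [|x [/(in_twP tw)[x2 x3] xE]] :=
    tw_smooth (cl := cl) (ax := ax) hp tw q_surj q_sq0 (s := s) (x' := x').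
    exact/(in_twP (cl := cl) (ax := ax) tw (q \o s)).
  exists (map_pt s pi x); split.
    by rewrite piE; apply/onM; rewrite !pt4E.
  rewrite piE xE; apply/ffunP; apply: forall_I4; rewrite !ffunE.
  - rewrite rmorphN rmorphM /=.
    by have := x'0; rewrite xE !ffunE.
  - by have := x'1; rewrite xE !ffunE rmorph0.
  - by [].
  - by [].
exists U, (group_of_sub M), pi; split; first exact: tw_unipotent_radical.
  apply: retraction_quotient => [R s|R s x /onM[x0 x1 _ _]|R s x Gx].
  - split=> [x /(in_twP tw)[x2 x3]|x x' Gx Gx'].
      by rewrite piE; apply/onM; rewrite !pt4E.
    rewrite !piE [mul_pt (G := group_of_sub M) _ _ _](tw_mul_ptE tw).
    rewrite (tw_mul_ptE tw) /tw_mul !pt4E.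
    have /(in_twP tw)[x2 x3] := Gx'.
    by rewrite [tw_cocycle _ _ _]coc ?pt4E // mulr0 !addr0; congr pt4; ring.
  - by rewrite piE; symmetry; apply: eq_pt4.
  rewrite piE (tw_one_ptE _ _ tw); split=> [h|].
    apply/(in_radicalP (U := U)) => //; have := congr1 (fun z : {ffun _} => z o2) h.
    by have := congr1 (fun z : {ffun _} => z o3) h; rewrite !pt4E.
  by move/(in_radicalP (U := U)) => -[] // -> ->; rewrite mulr0 oppr0.
apply: retraction_restricts_to_iso => R s x /onM[x0 x1 _ _].
by rewrite piE; symmetry; apply: eq_pt4.
Qed.
End Levi.

Section LeviLocalGlobal.
Variables (F : fieldType) (p : nat) (hp : p \in [pchar F]) (f : F).

Lemma root_artin_schreier (E : fieldType) (c y : E) :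
  root (artin_schreier p c) y = (y ^+ p - y == c).
Proof. by rewrite /root /artin_schreier !(hornerE, hornerXn) subr_eq0. Qed.

Lemma map_artin_schreier (E : fieldType) (iota : {rmorphism F -> E}) :
  map_poly iota (artin_schreier p f) = artin_schreier p (iota f).
Proof. by rewrite /artin_schreier !rmorphB /= map_polyXn map_polyX map_polyC. Qed.

Lemma tw_group_levi (E : fieldType) (iota : {rmorphism F -> E}) :
  as_splits_over p f iota -> has_levi_factor (base_change iota (tw_group hp f)).
Proof.
move=> [y]; rewrite map_artin_schreier root_artin_schreier => /eqP yE.
exact: (artin_schreier_levi (rmorph_pchar iota hp) _ _
  (is_tw_group_bc iota (tw_gE p f)) yE).
Qed.

Lemma tw_group_no_levi : as_nontrivial p f -> ~ has_levi_factor (tw_group hp f).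
Proof.
move=> f_nt /(levi_artin_schreier hp (tw_gE p f)) [y /eqP yE].
by apply: f_nt; exists y; rewrite root_artin_schreier.
Qed.
End LeviLocalGlobal.

(** * Discrete valuations *)

Section Valuation.
Variables (F : fieldType) (v : discreteValuation F).
Implicit Types (x y z : F) (n m : int).

Lemma dvalM x y : x != 0 -> y != 0 -> v (x * y) = v x + v y.
Proof. by case: v => w wM ? ? /=; apply: wM. Qed.

Lemma dval1 : v 1 = 0.
Proof.
have := dvalM (oner_neq0 F) (oner_neq0 F); rewrite mulr1 => /eqP.
by rewrite -subr_eq0 opprD addrA subrr add0r oppr_eq0 => /eqP.
Qed.

Lemma dvalX x (k : nat) : x != 0 -> v (x ^+ k) = v x *+ k.
Proof.
move=> x0; elim: k => [|k IH]; first by rewrite expr0 dval1.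
by rewrite exprS mulrS dvalM ?expf_neq0 // IH.
Qed.

Lemma dvalN x : x != 0 -> v (- x) = v x.
Proof.
move=> x0; have N0 : -1 != 0 :> F by rewrite oppr_eq0 oner_neq0.
have N1 : v (-1) = 0.
  by have := dvalX 2 N0; rewrite sqrrN expr1n dval1; lia.
by rewrite -mulN1r dvalM // N1 add0r.
Qed.

Lemma dvalV x : x != 0 -> v x^-1 = - v x.
Proof.
move=> x0; have := dvalM x0 (invr_neq0 x0); rewrite mulfV // dval1; lia.
Qed.

(** This encodes the convention that 0 has value +oo, as [dval] leaves the value at 0 open. *)
Definition vge n z : Prop := z = 0 \/ n <= v z.

Lemma vge_closeE n x y : dval_close v n x y <-> vge n (x - y).
Proof.
split=> [h|[/subr0_eq->|vxy _ //]]; last by move/eqP.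
by have [->|/h] := eqVneq x y; [left; rewrite subrr | right].
Qed.

Lemma vge0 n : vge n 0. Proof. by left. Qed.

Lemma vge1 : vge 0 1. Proof. by right; rewrite dval1. Qed.

Lemma vge_neq0 n z : z != 0 -> vge n z -> n <= v z.
Proof. by move=> /eqP z0 []. Qed.

Lemma vge_le n m z : n <= m -> vge m z -> vge n z.
Proof. by move=> nm [->|mz]; [left | right; apply: le_trans mz]. Qed.

Lemma vgeD n x y : vge n x -> vge n y -> vge n (x + y).
Proof.
have [->|x0] := eqVneq x 0; first by rewrite add0r.
have [->|y0] := eqVneq y 0; first by rewrite addr0.
move=> /(vge_neq0 x0) nx /(vge_neq0 y0) ny.
have [->|xy0] := eqVneq (x + y) 0; first by left.
right; case: v x0 y0 xy0 nx ny => w wM wD w1 /= x0 y0 xy0 nx ny.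
by apply: le_trans (wD _ _ x0 y0 xy0); rewrite le_min nx.
Qed.

Lemma vgeN n x : vge n x -> vge n (- x).
Proof.
have [->|x0] := eqVneq x 0; first by rewrite oppr0.
by move=> /(vge_neq0 x0) nx; right; rewrite dvalN.
Qed.

Lemma vgeB n x y : vge n x -> vge n y -> vge n (x - y).
Proof. by move=> nx /vgeN; apply: vgeD. Qed.

Lemma vgeM n m x y : vge n x -> vge m y -> vge (n + m) (x * y).
Proof.
have [->|x0] := eqVneq x 0; first by rewrite mul0r; left.
have [->|y0] := eqVneq y 0; first by rewrite mulr0; left.
move=> /(vge_neq0 x0) nx /(vge_neq0 y0) ny.
by right; rewrite dvalM // lerD.
Qed.

Lemma vgeM0 n x y : vge 0 x -> vge n y -> vge n (x * y).
Proof. by rewrite -{2}[n]add0r; apply: vgeM. Qed.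

Lemma vgeX0 (k : nat) x : vge 0 x -> vge 0 (x ^+ k).
Proof.
move=> vx; elim: k => [|k IH]; first by rewrite expr0; apply: vge1.
by rewrite exprS; apply: vgeM0.
Qed.

Lemma vgeX1 (k : nat) x : vge 1 x -> vge k%:Z (x ^+ k).
Proof.
move=> vx; elim: k => [|k IH]; first by rewrite expr0; apply: vge1.
by rewrite exprS intS; apply: vgeM.
Qed.

Lemma dvalD_lt x y : x != 0 -> vge (v x + 1) y -> x + y != 0 /\ v (x + y) = v x.
Proof.
move=> x0 vy; have [y0|y0] := eqVneq y 0; first by rewrite y0 addr0.
have vxy := vge_neq0 y0 vy.
have xy0 : x + y != 0.
  by rewrite addr_eq0; apply/eqP => xy; move: vxy; rewrite xy dvalN //; lia.
split=> //; apply/eqP; rewrite eq_le; apply/andP; split; last first.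
  by apply: (vge_neq0 xy0); apply: vgeD; right => //; lia.
rewrite leNgt; apply/negP => lt_xy.
have : vge (v x + 1) x.
  have xE : x = x + y - y by rewrite addrK.
  rewrite {2}xE; apply: vgeB => //; right; lia.
by move/(vge_neq0 x0); lia.
Qed.

Lemma vge_eq0 x : (forall n, vge n x) -> x = 0.
Proof. by move=> h; case: (h (v x + 1)) => //; lia. Qed.

Lemma dval_unif : exists2 x, x != 0 & v x = 1.
Proof. by case: v => w ? ? [x [x0 wx]]; exists x. Qed.
End Valuation.

(** * Artin-Schreier equations over complete fields *)

Section Hensel.
Variables (F : fieldType) (v : discreteValuation F) (p : nat).
Hypotheses (hp : p \in [pchar F]) (v_complete : dval_complete v).

(* The root is -(h + h^p + h^(p^2) + ...). *)
Lemma hensel_artin_schreier h : vge v 1 h -> exists y, y ^+ p - y = h.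
Proof.
move=> vh; pose u k := - \sum_(0 <= i < k) h ^+ (p ^ i).
have p_gt1 := prime_gt1 (pcharf_prime hp).
have vhX k i : (k <= i)%N -> vge v k%:Z (h ^+ (p ^ i)).
  move=> ki; apply: vge_le (vgeX1 _ vh); rewrite lez_nat.
  by apply: leq_trans ki (ltnW (ltn_expl _ p_gt1)).
have uS k : u k.+1 = u k - h ^+ (p ^ k).
  by rewrite /u big_nat_recr //= opprD.
(* The sum telescopes, leaving an error h^(p^k) that tends to 0. *)
have uE k : u k ^+ p - u k = h - h ^+ (p ^ k).
  elim: k => [|k IH]; first by rewrite /u big_nil oppr0 (expr0p hp) expr1 !subrr.
  rewrite uS (exprpD hp) [(- (h ^+ _)) ^+ p](exprpN hp) -exprM -expnSr.
  rewrite (_ : _ - _ = (u k ^+ p - u k) + h ^+ (p ^ k) - h ^+ (p ^ k.+1)).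
    by rewrite IH; ring.
  by move: (u k ^+ p) => up; ring.
have u_cauchy k i : (k <= i)%N -> vge v k%:Z (u i - u k).
  move=> ki; rewrite -(subnK ki); elim: (i - k)%N => [|j IH].
    by rewrite subrr; apply: vge0.
  rewrite addSn uS addrAC; apply: vgeB => //; apply: vhX; exact: leq_addl.
have vnat (n : int) (N : nat) z : (`|n| <= N)%N -> vge v N%:Z z -> vge v n z.
  by move=> nN; apply: vge_le; lia.
have [n|l ul] := v_complete (u := u).
  exists `|n|%N => i j ni nj; apply/vge_closeE.
  rewrite -(subrKA (u `|n|%N)); apply: vgeD; apply: (vnat n `|n|%N) => //.
    exact: u_cauchy.
  by rewrite -opprB; apply/vgeN/u_cauchy.
exists l; apply/eqP; rewrite -subr_eq0; apply/eqP/(vge_eq0 (v := v)) => n0.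
(* Taking the bound nonnegative makes d integral, so that d^p is at least as small as d. *)
pose n : int := `|n0|; apply: (@vge_le _ _ _ n); first by rewrite /n; lia.
have [N hN] := ul n; pose k := maxn N `|n|%N.
have /vge_closeE/vgeN := hN k (leq_maxl _ _); rewrite opprB; set d := l - u k.
move=> vd; have -> : l ^+ p - l - h = d ^+ p - d - h ^+ (p ^ k).
  have -> : l = d + u k by rewrite /d subrK.
  rewrite (exprpD hp).
  rewrite (_ : _ - h = d ^+ p - d + (u k ^+ p - u k) - h); last first.
    by move: (d ^+ p) (u k ^+ p) => dp up; ring.
  by rewrite uE; move: (d ^+ p) (h ^+ _) => dp hk; ring.
apply: vgeB; last by apply: (vnat n k); [exact: leq_maxr | exact: vhX].
apply: vgeB => //; rewrite -(prednK (ltnW p_gt1)) exprSr; apply: vgeM0 => //.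
by apply: vgeX0; apply: vge_le vd.
Qed.
End Hensel.

Lemma local_splitting (F : fieldType) (v : discreteValuation F) (p : nat) (h g : F)
    (Fv : fieldType) (iota : {rmorphism F -> Fv}) :
  p \in [pchar F] -> vge v 1 (h - (g ^+ p - g)) -> is_completion v iota ->
  exists y : Fv, y ^+ p - y = iota h.
Proof.
move=> hp vh [w [wv w_complete _]]; have hpv := rmorph_pchar iota hp.
have [|y yE] := @hensel_artin_schreier _ w _ hpv w_complete (iota (h - (g ^+ p - g))).
  case: vh => [->|vh]; first by rewrite rmorph0; left.
  have [->|h0] := eqVneq (h - (g ^+ p - g)) 0; first by rewrite rmorph0; left.
  by right; rewrite wv.
exists (y + iota g); rewrite (exprpD hpv).
rewrite (_ : _ - _ = (y ^+ p - y) + (iota g ^+ p - iota g)).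
  by rewrite yE !rmorphB rmorphXn /= subrK.
by move: (y ^+ p) (iota g ^+ p) => yp gp; ring.
Qed.

(** * Function fields of Weierstrass curves *)

Lemma forall_I2 (P : 'I_2 -> Prop) : P (inord 0) -> P (inord 1) -> forall i, P i.
Proof.
move=> P0 P1 i; rewrite -(inord_val i).
by case: i => [[|[|i]] lt_i].
Qed.

Section QuadraticExtension.
Variables (K F : fieldType) (s : {rmorphism K -> F}).
Implicit Types (x y z : F) (A B D : {poly K}).

Definition ev x A : F := (map_poly s A).[x].

Lemma evD x A B : ev x (A + B) = ev x A + ev x B.
Proof. by rewrite /ev rmorphD hornerD. Qed.
Lemma evN x A : ev x (- A) = - ev x A.
Proof. by rewrite /ev rmorphN hornerN. Qed.
Lemma evM x A B : ev x (A * B) = ev x A * ev x B.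
Proof. by rewrite /ev rmorphM hornerM. Qed.
Lemma evXn x A k : ev x (A ^+ k) = ev x A ^+ k.
Proof. by rewrite /ev rmorphXn horner_exp. Qed.
Lemma evX x : ev x 'X = x.
Proof. by rewrite /ev map_polyX hornerX. Qed.
Lemma evC x c : ev x c%:P = s c.
Proof. by rewrite /ev map_polyC hornerC. Qed.
Lemma ev0 x : ev x 0 = 0.
Proof. by rewrite /ev rmorph0 horner0. Qed.
Lemma ev1 x : ev x 1 = 1.
Proof. by rewrite evC rmorph1. Qed.
Lemma ev_comp x A B : ev x (A \Po B) = ev (ev x B) A.
Proof. by rewrite /ev map_comp_poly horner_comp. Qed.
Definition evE := (evD, evN, evM, evXn, evX, evC, ev0, ev1).

(** [F] has basis (1, y) over K(x) with x transcendental, stated with denominators cleared so that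
    only polynomials in x occur. *)
Definition quadratic_gens x y : Prop :=
  (forall z, exists A B D, ev x D != 0 /\ z * ev x D = ev x A + ev x B * y) /\
  (forall A B, ev x A + ev x B * y = 0 -> A = 0 /\ B = 0).

Lemma quadratic_gens_subst x y x' y' (a b c d e : K) :
  quadratic_gens x y -> a != 0 -> c != 0 ->
  x = s a * x' + s b -> y = s c * y' + s d * x' + s e -> quadratic_gens x' y'.
Proof.
move=> [gen free] a0 c0 xE yE; have [sa0 sc0] : s a != 0 /\ s c != 0.
  by rewrite !fmorph_eq0.
pose L := a *: 'X + b%:P; pose L' := a^-1 *: ('X - b%:P).
have LE : ev x' L = x by rewrite /L -mul_polyC !evE xE.
have L'E : ev x L' = x'.
  by rewrite /L' -mul_polyC !evE fmorphV xE; field.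
have L'L A : (A \Po L') \Po L = A.
  rewrite -comp_polyA (_ : L' \Po L = 'X) ?comp_polyXr //.
  rewrite /L' comp_polyZ comp_polyB comp_polyX comp_polyC /L addrK.
  by rewrite scalerA mulVf // scale1r.
split=> [z|A B AB].
  have [A [B [D [D0 zE]]]] := gen z.
  exists ((A \Po L) + (B \Po L) * (d *: 'X + e%:P)), (c *: (B \Po L)), (D \Po L).
  rewrite -!mul_polyC !evE !ev_comp LE zE; split=> //; rewrite yE. ring.
have yE' : y' = s c^-1 * y - ev x (c^-1 *: (d *: L' + e%:P)).
  by rewrite -!mul_polyC !evE L'E yE !fmorphV; field.
have [|H H'] := free ((A \Po L') - (B \Po L') * (c^-1 *: (d *: L' + e%:P)))
  (c^-1 *: (B \Po L')).
  by rewrite -AB yE' -!mul_polyC !evE !ev_comp L'E; ring.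
have B0 : B \Po L' = 0.
  by move/eqP: H'; rewrite scaler_eq0 invr_eq0 (negPf c0) => /eqP.
move: H; rewrite B0 mul0r subr0 => A0.
by rewrite -(L'L A) -(L'L B) A0 B0 !comp_poly0.
Qed.
End QuadraticExtension.

Section FunctionField.
Variables (K : fieldType) (W : weierstrass K).

Definition wlin : {poly K} := wa1 W *: 'X + (wa3 W)%:P.
Definition wcub : {poly K} :=
  'X ^+ 3 + wa2 W *: 'X ^+ 2 + wa4 W *: 'X + (wa6 W)%:P.

Lemma weval_map (R S : comNzRingType) (s : {rmorphism K -> R})
    (phi : {rmorphism R -> S}) x y :
  phi (weval W s x y) = weval W (phi \o s) (phi x) (phi y).
Proof. by rewrite /weval !(rmorphB, rmorphD, rmorphM, rmorphXn). Qed.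

Lemma wevalE (F : fieldType) (s : {rmorphism K -> F}) x y :
  weval W s x y = y ^+ 2 + ev s x wlin * y - ev s x wcub.
Proof. by rewrite /weval /wlin /wcub -!mul_polyC !evE; ring. Qed.

(** Freeness: read in K[x][y] through [Phi], a relation of degree at most 1 in y is a multiple of a
    monic quadratic in y, hence 0. Generation: denominators are moved into K[x] by multiplying with
    the conjugate. *)
Lemma function_field_gens (F : fieldType) (s : {rmorphism K -> F}) :
  is_function_field W s ->
  exists x y, weval W s x y = 0 /\ quadratic_gens s x y.
Proof.
move=> [P [ker gen]]; set x := P (inord 0); set y := P (inord 1).
have wE : weval W s x y = 0.
  have <- : mmap s P (wpoly W) = weval W s x y.
    rewrite [LHS]weval_map /= /wvarx /wvary !mmapX !mmap1U.
    by rewrite /weval /= !mmapC.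
  by apply/ker; exists 1; rewrite mul1r.
have y2E : y ^+ 2 = ev s x wcub - ev s x wlin * y.
  by move: wE; rewrite wevalE => /eqP; rewrite subr_eq0 => /eqP<-; rewrite addrK.
pose lift A := (map_poly (@mpolyC 2 K) A).[wvarx K].
have liftE (S : comNzRingType) (phi : {rmorphism {mpoly K[2]} -> S}) A :
    phi (lift A) = (map_poly (phi \o @mpolyC 2 K) A).[phi (wvarx K)].
  by rewrite /lift -horner_map map_poly_comp.
have free A B : ev s x A + ev s x B * y = 0 -> A = 0 /\ B = 0.
  have liftx D : mmap s P (lift D) = ev s x D.
    rewrite liftE /wvarx /= mmapX mmap1U /ev; congr (_.[_]).
    by apply: eq_map_poly => c /=; rewrite mmapC.
  have yE : mmap s P (wvary K) = y by rewrite /wvary mmapX mmap1U.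
  rewrite -!liftx -yE -rmorphM -rmorphD => /ker [c].
  pose h (i : 'I_2) : {poly {poly K}} := if i == inord 0 then 'X%:P else 'X.
  pose Phi : {rmorphism {mpoly K[2]} -> {poly {poly K}}} :=
    mmap (polyC \o polyC : {rmorphism K -> {poly {poly K}}}) h.
  have PhiX : Phi (wvarx K) = 'X%:P by rewrite /Phi /= mmapX mmap1U /h eqxx.
  have PhiY : Phi (wvary K) = 'X.
    by rewrite /Phi /= mmapX mmap1U /h -val_eqE /= !inordK.
  have PhiL D : Phi (lift D) = D%:P.
    rewrite liftE PhiX -[RHS](congr1 polyC (comp_polyXr D)).
    rewrite /comp_poly -horner_map -map_poly_comp; congr (_.[_]).
    by apply: eq_map_poly => k /=; rewrite mmapC.
  move/(congr1 Phi); rewrite rmorphD !rmorphM !PhiL PhiY.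
  have -> : Phi (wpoly W) = 'X ^+ 2 + wlin%:P * 'X - wcub%:P.
    rewrite [LHS]weval_map PhiX PhiY /weval /= !mmapC /wlin /wcub /=.
    rewrite -!mul_polyC !(rmorphD, rmorphM, rmorphXn) /=; ring.
  set w := (X in _ = _ * X) => AB.
  have sw : size w = 3%N.
    rewrite /w -addrA size_polyDl size_polyXn //.
    apply: leq_ltn_trans (size_polyD _ _) _; rewrite gtn_max size_polyN.
    rewrite (leq_ltn_trans (size_polyC_leq1 _)) // andbT.
    apply: leq_ltn_trans (size_polyMleq _ _) _; rewrite size_polyX addn2 /=.
    by rewrite ltnS ltnS size_polyC_leq1.
  have [c0|c0] := eqVneq (Phi c) 0; last first.
    have : (size (A%:P + B%:P * 'X : {poly {poly K}})%R <= 2)%N.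
      apply: leq_trans (size_polyD _ _) _; rewrite geq_max.
      rewrite (leq_trans (size_polyC_leq1 _)) //=.
      apply: leq_trans (size_polyMleq _ _) _; rewrite size_polyX addn2 /=.
      by rewrite ltnS size_polyC_leq1.
    rewrite AB size_mul // -?size_poly_gt0 ?sw // addn3 /=.
    by move: c0; rewrite -size_poly_gt0; case: size.
  move: AB; rewrite c0 mul0r => AB.
  have := congr1 (fun q : {poly {poly K}} => q`_0) AB.
  have := congr1 (fun q : {poly {poly K}} => q`_1) AB.
  rewrite !coefD !coefMX !coefC /= add0r addr0.
  by [].
exists x, y; split=> //; split=> // z.
pose S z := exists A B, z = ev s x A + ev s x B * y.
have SP q : S (mmap s P q).
  elim/mpoly_ring_ind: q => [c||q r|q r].
  - by rewrite mmapC; exists c%:P, 0; rewrite !evE; ring.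
  - apply: forall_I2; rewrite mmapX mmap1U -/x -/y.
      by exists (polyX K), 0; rewrite !evE; ring.
    by exists 0, 1; rewrite !evE; ring.
  - move=> [A [B qE]] [A' [B' rE]]; exists (A + A'), (B + B').
    by rewrite rmorphD /= qE rE !evE; ring.
  move=> [A [B qE]] [A' [B' rE]].
  exists (A * A' + B * B' * wcub), (A * B' + A' * B - B * B' * wlin).
  rewrite rmorphM /= qE rE !evD !evN !evM.
  transitivity (ev s x A * ev s x A' + (ev s x A * ev s x B' + ev s x A' * ev s x B) * y
    + ev s x B * ev s x B' * y ^+ 2); first by ring.
  by rewrite y2E; ring.
have [q [r [r0 zE]]] := gen z.
have [A [B qE]] := SP q; have [A' [B' rE]] := SP r.
(* The conjugate replaces y by the other root -y - [wlin](x) of its quadratic equation; [N] is the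
   norm. *)
pose conj := ev s x (A' - B' * wlin) + ev s x (- B') * y.
pose N := A' ^+ 2 - A' * B' * wlin - B' ^+ 2 * wcub.
have NE : mmap s P r * conj = ev s x N.
  rewrite rE /conj /N !evD !evN !evXn !evM.
  transitivity (ev s x A' ^+ 2 - ev s x A' * ev s x B' * ev s x wlin
    - ev s x B' ^+ 2 * (y ^+ 2 + ev s x wlin * y)); first by ring.
  by rewrite y2E; ring.
have c0 : conj != 0.
  apply/eqP => /free [A'0 /eqP]; rewrite oppr_eq0 => /eqP B'0.
  move: r0 A'0; rewrite rE B'0 mul0r subr0 => + A'0.
  by rewrite A'0 !evE mul0r addr0 eqxx.
have [A'' [B'' qc]] : S (mmap s P q * conj).
  rewrite qE /conj; move: (A' - _) (- B') => C C'.
  exists (A * C + B * C' * wcub), (A * C' + C * B - B * C' * wlin).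
  rewrite !evD !evN !evM.
  transitivity (ev s x A * ev s x C + (ev s x A * ev s x C' + ev s x C * ev s x B) * y
    + ev s x B * ev s x C' * y ^+ 2); first by ring.
  by rewrite y2E; ring.
exists A'', B'', N; rewrite -NE mulf_neq0 //; split=> //.
by rewrite -qc zE; field.
Qed.
End FunctionField.

(** * Residues, and Artin-Schreier extensions in characteristic two *)

Section ClosedField.
Variable K : closedFieldType.

Lemma closed_nth_root (n : nat) (c : K) : (0 < n)%N -> exists d, d ^+ n = c.
Proof.
move=> n0; have [|d] := @closed_rootP K ('X^n - c%:P) _.
  by rewrite size_XnsubC // eqSS -lt0n.
by rewrite /root !hornerE subr_eq0 => /eqP; exists d.
Qed.

Lemma closed_artin_schreier (p : nat) (c : K) :
  (1 < p)%N -> exists d, d ^+ p - d = c.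
Proof.
move=> p1; have [|d] := @closed_rootP K (artin_schreier p c) _; last first.
  by rewrite root_artin_schreier => /eqP; exists d.
rewrite /artin_schreier -addrA size_polyDl size_polyXn ?eqSS ?gtn_eqF ?(ltnW p1) //.
apply: leq_ltn_trans (size_polyD _ _) _; rewrite !size_polyN size_polyX gtn_max.
by apply/andP; split; [|apply: leq_ltn_trans (size_polyC_leq1 _) _; exact: ltnW].
Qed.
End ClosedField.

Section Residues.
Variables (K : closedFieldType) (F : fieldType) (s : {rmorphism K -> F}).
Variable v : discreteValuation F.
Implicit Types (x y : F) (A : {poly K}).

(* The value of a constant is divisible by every n, as K^* is divisible. *)
Lemma dval_const (c : K) : c != 0 -> v (s c) = 0.
Proof.
(* An exponent larger than the absolute value of v(c) must divide v(c), which is therefore 0. *)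
move=> c0; have [d dE] := @closed_nth_root K `|v (s c)|.+1 c isT.
have d0 : d != 0.
  by apply: contraNneq c0 => d0; rewrite -dE d0 expr0n.
have := dvalX v `|v (s c)|.+1 (x := s d); rewrite fmorph_eq0 -rmorphXn dE => /(_ d0).
move: (v (s c)) (v (s d)) => a t; rewrite -mulr_natr pmulrn intz => aE.
have := congr1 absz aE; rewrite abszM absz_nat mulnS; case: (absz t) => [|n].
  by rewrite add0n mul0n => /eqP; rewrite absz_eq0 => /eqP.
by rewrite mulSn; lia.
Qed.

Lemma vge_const (c : K) : vge v 0 (s c).
Proof.
have [->|c0] := eqVneq c 0; first by left; rewrite rmorph0.
by right; rewrite dval_const.
Qed.

Lemma vge_sum (n : int) (I : Type) (r : seq I) (P : pred I) (G : I -> F) :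
  (forall i, P i -> vge v n (G i)) -> vge v n (\sum_(i <- r | P i) G i).
Proof.
move=> vG; apply: (big_ind (vge v n)); [exact: vge0 | exact: vgeD | exact: vG].
Qed.

Lemma vge_ev x A : vge v 0 x -> vge v 0 (ev s x A).
Proof.
move=> vx; elim/poly_ind: A => [|A c IH]; first by rewrite ev0; apply: vge0.
by rewrite evD evM evX evC; apply/vgeD/vge_const; apply: vgeM0.
Qed.

Lemma vge_ev_residue x (x0 : K) A :
  vge v 1 (x - s x0) -> vge v 0 x -> vge v 1 (ev s x A - s A.[x0]).
Proof.
move=> vx1 vx; have /factor_theorem[q qE] : root (A - A.[x0]%:P) x0.
  by rewrite /root !hornerE subrr.
have -> : ev s x A - s A.[x0] = ev s x q * (x - s x0).
  by rewrite -(evC s x) -evN -evD qE evM evD evN evX evC.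
by apply: vgeM0 => //; apply: vge_ev.
Qed.

Lemma vge1_mul x y :
  vge v 0 x -> vge v 0 y -> vge v 1 (x * y) -> vge v 1 x \/ vge v 1 y.
Proof.
have [->|x0] := eqVneq x 0; first by left; apply: vge0.
have [->|y0] := eqVneq y 0; first by right; apply: vge0.
move=> /(vge_neq0 x0) vx /(vge_neq0 y0) vy /(vge_neq0 (mulf_neq0 x0 y0)).
rewrite dvalM // => vxy; have [|] := ltP 0 (v x); first by left; right; lia.
by right; right; lia.
Qed.

Lemma dvalB_const x (c : K) : x != 0 -> v x < 0 -> x - s c != 0 /\ v (x - s c) = v x.
Proof.
move=> x0 vx; apply: dvalD_lt => //; apply/vgeN; apply: vge_le (vge_const c); lia.
Qed.

Lemma vge_ev_pole x A (k : nat) :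
  x != 0 -> v x < 0 -> (size A <= k.+1)%N -> vge v 0 (ev s x A * x^-1 ^+ k).
Proof.
move=> x0 vx sA; rewrite /ev horner_coef mulr_suml; apply: vge_sum => i _.
have ik : (i <= k)%N.
  by rewrite -ltnS; apply: leq_trans sA; apply: leq_trans (ltn_ord i) (size_poly _ _).
rewrite coef_map -mulrA; apply: vgeM0; first exact: vge_const.
rewrite -(subnKC ik) exprD mulrA -exprMn mulfV // expr1n mul1r.
by apply: vgeX0; right; rewrite dvalV //; lia.
Qed.

(** Otherwise every x - c is a unit at v, and so is every nonzero polynomial in x, since [K] is
    algebraically closed. But y is integral by its monic equation, and the norm of the numerator of
    a uniformizer is a polynomial in x of value at least 1. *)
Lemma residue_exists (L C : {poly K}) x y :
  quadratic_gens s x y -> y ^+ 2 + ev s x L * y = ev s x C ->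
  vge v 0 x -> exists x0 : K, vge v 1 (x - s x0).
Proof.
move=> [gen free] yE vx; apply: NNPP => no_res.
have vA0 A : A != 0 -> ev s x A != 0 /\ v (ev s x A) = 0.
  have [r rE] := closed_field_poly_normal A; rewrite -lead_coef_eq0 => lA.
  have sl : s (lead_coef A) != 0 by rewrite fmorph_eq0.
  rewrite rE -mul_polyC evM evC; move: {rE lA} (lead_coef A) lA sl => l l0 sl0.
  suff [H1 H2] : ev s x (\prod_(z <- r) ('X - z%:P)) != 0 /\
      v (ev s x (\prod_(z <- r) ('X - z%:P))) = 0.
    by rewrite mulf_neq0 // dvalM // H2 dval_const.
  elim: r => [|z r [IH1 IH2]]; first by rewrite big_nil ev1 oner_neq0 dval1.
  rewrite big_cons evM evD evN evX evC.
  have z0 : x - s z != 0.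
    by apply/eqP => z0; apply: no_res; exists z; rewrite z0; apply: vge0.
  rewrite mulf_neq0 // dvalM // IH2 addr0; split=> //.
  have : vge v 0 (x - s z) by apply: vgeB => //; apply: vge_const.
  move/(vge_neq0 z0) => z_ge; apply/eqP; rewrite eq_le z_ge andbT leNgt.
  by apply/negP => z_gt; apply: no_res; exists z; right; rewrite -gtz0_ge1.
have vy : vge v 0 y.
  have [->|y0] := eqVneq y 0; first exact: vge0.
  right; rewrite leNgt; apply/negP => y_lt.
  have [|yL0 vyL] := dvalD_lt (v := v) (y := ev s x L) y0.
    by apply: vge_le (vge_ev L vx); lia.
  have : vge v 0 (y * (y + ev s x L)).
    by rewrite mulrDr -expr2 [y * ev _ _ _]mulrC yE; apply: vge_ev.
  by move/(vge_neq0 (mulf_neq0 y0 yL0)); rewrite dvalM // vyL; lia.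
have [t t0 vt] := dval_unif v; have [A [B [D [D0 tE]]]] := gen t.
have AB0 : ev s x A + ev s x B * y != 0 by rewrite -tE mulf_neq0.
have Dn0 : D != 0 by apply: contraNneq D0 => ->; rewrite ev0.
have vAB : v (ev s x A + ev s x B * y) = 1.
  by rewrite -tE dvalM // vt; have [_ ->] := vA0 D Dn0.
set conj := ev s x (A - B * L) + ev s x (- B) * y.
have conj0 : conj != 0.
  apply/eqP => /free [A0 /eqP]; rewrite oppr_eq0 => /eqP B0.
  by move: A0 AB0; rewrite B0 mul0r subr0 => ->; rewrite !ev0 mul0r addr0 eqxx.
have vconj : vge v 0 conj.
  by apply: vgeD; [apply: vge_ev | apply: vgeM0 => //; apply: vge_ev].
pose N := A ^+ 2 - A * B * L - B ^+ 2 * C.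
have NE : (ev s x A + ev s x B * y) * conj = ev s x N.
  rewrite /conj /N !evD !evN !evXn !evM -yE; ring.
have N0 : N != 0.
  by apply/eqP => N0; move: NE; rewrite N0 ev0 => /eqP; apply/negP; rewrite mulf_neq0.
have [_] := vA0 N N0; rewrite -NE dvalM // vAB.
by have := vge_neq0 conj0 vconj; lia.
Qed.
End Residues.

(* The second part says that z^p - z = h is solvable in every completion: modulo
   elements g^p - g, h has positive valuation, and Hensel's lemma applies. *)
Definition everywhere_locally_split (p : nat) (F : fieldType) (h : F) : Prop :=
  (forall z, z ^+ p - z <> h) /\
  (forall v : discreteValuation F, exists g, vge v 1 (h - (g ^+ p - g))).

(** * The curves y^2 + x y = x^3 + a x^2 + b x in characteristic two *)

Section CharacteristicTwo.
Variables (K : closedFieldType) (F : fieldType) (s : {rmorphism K -> F}).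
Variables (x y : F) (a b : K).
Hypotheses (h2 : 2%N \in [pchar K]) (b0 : b != 0) (gens : quadratic_gens s x y).
Hypothesis yE : y ^+ 2 + x * y = x ^+ 3 + s a * x ^+ 2 + s b * x.

Let cub : {poly K} := 'X ^+ 3 + a *: 'X ^+ 2 + b *: 'X.

(** Descent at X = 0: the equation gives X | A; after division by X its value at 0 is b B(0)^2, so X
    | B; and (A / X, B / X) is a smaller solution. *)
Lemma char2_norm_eq0 (A B : {poly K}) :
  A ^+ 2 - A * B * 'X + B ^+ 2 * (a *: 'X ^+ 2 + b *: 'X) = 0 -> B = 0.
Proof.
have [n] := ubnP (size B); elim: n A B => // n IH A B sB AB.
have /factor_theorem[A' A'E] : root A 0.
  have := congr1 (fun q => q.[0]) AB.
  rewrite !(hornerD, hornerN, hornerM, horner_exp, hornerZ, hornerX, hornerC).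
  rewrite !(mulr0, subr0, addr0).
  by move/eqP; rewrite mulf_eq0 orbb.
move: A'E; rewrite subr0 => A'E.
have AB' : A' ^+ 2 * 'X - A' * B * 'X + B ^+ 2 * (a *: 'X + b%:P) = 0.
  apply: (mulIf (negbT (polyX_eq0 K))); rewrite mul0r -AB A'E -!mul_polyC; ring.
have /factor_theorem[B' B'E] : root B 0.
  have := congr1 (fun q => q.[0]) AB'.
  rewrite !(hornerD, hornerN, hornerM, horner_exp, hornerZ, hornerX, hornerC).
  rewrite !(mulr0, subr0, oppr0, add0r).
  by move/eqP; rewrite !mulf_eq0 orbb (negPf b0) orbF.
move: B'E; rewrite subr0 => B'E.
have [B0|B0] := eqVneq B' 0; first by rewrite B'E B0 mul0r.
suff : B' = 0 by move/eqP; rewrite (negPf B0).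
apply: (IH A').
  by move: sB; rewrite B'E size_mulX // ltnS.
have X20 : 'X ^+ 2 != 0 :> {poly K} by rewrite expf_neq0 ?polyX_eq0.
by apply: (mulIf X20); rewrite mul0r -AB A'E B'E -!mul_polyC; ring.
Qed.

(** Dividing the equation of the curve by x^2 gives (y/x)^2 + y/x = x + a + b/x, so y/x plays the
    part of f, with h = x and, up to a constant, h' = b/x. *)
Lemma char2_locally_split : everywhere_locally_split 2 x.
Proof.
have hF := rmorph_pchar s h2; have [gen free] := gens.
have F2 : 2%:R = 0 :> F by apply: pcharf0 hF.
have K2 : 2%:R = 0 :> {poly K} by rewrite -polyCMn (pcharf0 h2).
split=> [z zE|v].
  have [A [B [D [D0 zD]]]] := gen z.
  have Dn0 : D != 0 by apply: contraNneq D0 => ->; rewrite ev0.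
  have [|] := free (A ^+ 2 + B ^+ 2 * cub - A * D - 'X * D ^+ 2)
    (2%:R * A * B - B ^+ 2 * 'X - B * D).
    rewrite !evD !evN !evXn !evM !evX /cub -!mul_polyC !evE.
    transitivity ((ev s x A + ev s x B * y) ^+ 2
       - (ev s x A + ev s x B * y) * ev s x D - x * ev s x D ^+ 2).
      rewrite (_ : x * (x * x) + _ + _ = y ^+ 2 + x * y); last by rewrite yE; ring.
      by ring.
    by rewrite -zD -zE; ring.
  (* Since 2 A B = 0, the coefficient of y is -B (B X + D). If B = 0, then A (A - D) = X D^2,
     impossible by degrees. If D = -B X, the cubic terms cancel and the quadratic form of
     [char2_norm_eq0] remains. *)
  rewrite K2 !mul0r sub0r => const0 /eqP.
  rewrite (_ : _ - _ = - (B * (B * 'X + D))); last by ring.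
  rewrite oppr_eq0 mulf_eq0 => /orP[/eqP B0|/eqP DE].
    move: const0; rewrite B0 expr0n mul0r addr0 => /eqP.
    rewrite subr_eq0 -[A ^+ 2]/(A * A) -mulrBr => /eqP AD.
    have sD : (0 < size D)%N by rewrite size_poly_gt0.
    have A0 : A != 0.
      apply/eqP => A0; move/eqP: AD; rewrite A0 mul0r eq_sym mulf_eq0 polyX_eq0.
      by rewrite expf_eq0 (negPf Dn0).
    have sXD : size ('X * D ^+ 2) = (2 * size D)%N.
      by rewrite mulrC size_mulX ?expf_neq0 // -[D ^+ 2]/(D * D) size_mul //;
        rewrite prednK ?addn_gt0 ?sD // mul2n addnn.
    have AD0 : A - D != 0.
      apply/eqP => AD0; move/eqP: AD; rewrite AD0 mulr0 eq_sym mulf_eq0 polyX_eq0.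
      by rewrite expf_eq0 (negPf Dn0).
    have := sXD; rewrite -AD size_mul //.
    have sA : (0 < size A)%N by rewrite size_poly_gt0.
    have [lt_DA|le_AD] := ltnP (size D) (size A).
      rewrite size_polyDl ?size_polyN //; move: sA sD lt_DA.
      by move: (size A) (size D) => i j; lia.
    have := size_polyD A (- D); rewrite size_polyN; move: sA sD le_AD.
    by move: (size A) (size D) (size (A - D)) => i j k; lia.
  have DE' : D = - (B * 'X) by apply/eqP; rewrite -addr_eq0 addrC DE.
  have B0 : B = 0.
    apply: (@char2_norm_eq0 (- A)); rewrite -const0 DE' /cub -!mul_polyC.
    rewrite (_ : _ + _ = A ^+ 2 + A * B * 'X
      + B ^+ 2 * (a%:P * 'X ^+ 2 + b%:P * 'X)); last by ring.
    by ring.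
  by move: Dn0; rewrite DE' B0 mul0r oppr0 eqxx.
have [x0|x0] := eqVneq x 0.
  by exists 0; rewrite x0 expr0n /= !subr0; apply: vge0.
have [vx|vx] := ltP (v x) 0.
  (* The constant k absorbs the term a, leaving -b/x, which vanishes at a pole of x. *)
  have [k kE] := closed_artin_schreier (- a) (isT : (1 < 2)%N).
  exists (y / x + s k); rewrite (_ : _ - _ = - (s b / x)).
    by apply/vgeN/vgeM0; [exact: vge_const | right; rewrite dvalV //; lia].
  have kE' : s k ^+ 2 = s k - s a.
    by rewrite -rmorphXn -rmorphB; congr (s _); rewrite -kE; ring.
  have yE' : y ^+ 2 = x ^+ 3 + s a * x ^+ 2 + s b * x - x * y by rewrite -yE addrK.
  rewrite (_ : _ - _ = x - (y ^+ 2 / x ^+ 2 + s k ^+ 2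
    + 2%:R * (y / x * s k) - y / x - s k)); last by field.
  rewrite kE' yE' F2 mul0r.
  rewrite (_ : _ - _ = 2%:R * (y / x) - s b / x); last by field.
  by rewrite F2 mul0r add0r.
have [|x1 vx1] := @residue_exists K F s v 'X cub x y gens _ (or_intror vx).
  by rewrite evX yE /cub -!mul_polyC !evE.
have [k kE] := closed_artin_schreier x1 (isT : (1 < 2)%N).
by exists (s k); rewrite -rmorphXn -rmorphB kE.
Qed.
End CharacteristicTwo.

(** * Artin-Schreier extensions in odd characteristic *)

Section LegendreCubic.
Variables (K : closedFieldType) (l : K).
Hypotheses (l0 : l != 0) (l1 : l != 1).

Definition legendre_cubic : {poly K} := 'X * ('X - 1%:P) * ('X - l%:P).
Local Notation g := legendre_cubic.

Lemma legendre_cubic_monic : g \is monic.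
Proof. by rewrite !rpredM ?monicX ?monicXsubC. Qed.

Lemma size_legendre_cubic : size g = 4%N.
Proof.
rewrite size_Mmonic ?monicXsubC ?mulf_neq0 ?polyX_eq0 ?polyXsubC_eq0 //.
by rewrite size_Mmonic ?monicXsubC ?polyX_eq0 // size_polyX !size_XsubC.
Qed.

Lemma legendre_cubic_squarefree (D : {poly K}) : D ^+ 2 %| g -> size D = 1%N.
Proof.
move=> D2g; apply/eqP; apply: contraT => /closed_rootP[z].
rewrite -dvdp_XsubCl => /(dvdp_exp2r 2)/dvdp_trans/(_ D2g).
case/dvdpP => q qE.
have w0 : ('X - z%:P).[z] = 0 by rewrite hornerXsubC subrr.
have g0 : g.[z] = 0 by rewrite qE expr2 mulrA hornerM w0 mulr0.
have g1 : g^`().[z] = 0.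
  by rewrite qE expr2 mulrA derivM hornerD !hornerM w0 !(mulr0, mul0r) addr0.
move: g0 g1; rewrite /g !derivM !(derivX, derivB, derivC).
rewrite !(hornerD, hornerM, hornerN, hornerX, hornerC) => /eqP.
rewrite !mulf_eq0 !subr_eq0 -orbA => /or3P[]/eqP-> /eqP.
- by rewrite (_ : _ + _ = l) ?(negPf l0) //; ring.
- by rewrite (_ : _ + _ = 1 - l) ?subr_eq0 1?eq_sym ?(negPf l1) //; ring.
- by rewrite (_ : _ + _ = l * (l - 1)) ?mulf_eq0 ?subr_eq0 ?(negPf l0)
    ?(negPf l1) //; ring.
Qed.

(* Coprime B, D: D^(2m) divides g^m, so D is constant, and then the degree of
   B^p g^m exceeds all others. *)
Lemma legendre_no_solution (m : nat) (B D P : {poly K}) (k : K) :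
  let p := m.*2.+1 in
  (0 < m)%N -> k != 0 -> P != 0 -> (size P <= m)%N -> D != 0 ->
  B ^+ p * g ^+ m - B * D ^+ p.-1 <> k *: (P * D ^+ p).
Proof.
move=> p m0 k0 P0 sP D0 BD; pose e := gcdp B D.
have e0 : e != 0 by rewrite gcdp_eq0 (negPf D0) andbF.
have [B' BE] : exists B', B = B' * e by apply/dvdpP/dvdp_gcdl.
have [D' DE] : exists D', D = D' * e by apply/dvdpP/dvdp_gcdr.
have D'0 : D' != 0 by apply: contraNneq D0 => D'0; rewrite DE D'0 mul0r.
have cop : coprimep B' D'.
  have : coprimep (B %/ e) (D %/ e) by rewrite coprimep_div_gcd // D0 orbT.
  by rewrite {1}BE {1}DE !mulpK.
have BD' : B' ^+ p * g ^+ m = D' ^+ p.-1 * (B' + k *: (P * D')).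
  apply: (mulIf (expf_neq0 p e0)).
  transitivity (B ^+ p * g ^+ m); first by rewrite BE [(_ * e) ^+ p]exprMn mulrAC.
  have -> : B ^+ p * g ^+ m = B * D ^+ p.-1 + k *: (P * D ^+ p).
    by rewrite -BD addrC subrK.
  by rewrite BE DE ![(_ * e) ^+ _]exprMn /p /= !(exprS _ m.*2) -!mul_polyC; ring.
have D'1 : size D' = 1%N.
  apply: legendre_cubic_squarefree.
  rewrite -(dvdp_pexp2r _ _ m0) -exprM mul2n.
  have : D' ^+ p.-1 %| B' ^+ p * g ^+ m by rewrite BD' dvdp_mulr.
  rewrite Gauss_dvdpr //; apply: coprimep_expl; apply: coprimep_expr.
  by rewrite coprimep_sym.
have /size_poly1P[d d0 dE] : size D' == 1%N by apply/eqP.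
have [B'0|B'0] := eqVneq B' 0.
  move: BD' => /eqP; rewrite B'0 exprS !mul0r add0r eq_sym mulf_eq0 expf_eq0.
  by rewrite (negPf D'0) andbF scaler_eq0 (negPf k0) mulf_eq0 (negPf P0) (negPf D'0).
have := congr1 (fun q : {poly K} => size q) BD'.
rewrite size_Mmonic ?expf_neq0 ?monic_exp ?legendre_cubic_monic //.
have sg : size (g ^+ m) = (3 * m).+1.
  have := size_exp g m; rewrite size_legendre_cubic => <-.
  by rewrite prednK // size_poly_gt0 expf_neq0 ?monic_neq0 ?legendre_cubic_monic.
rewrite sg dE -rmorphXn /= mul_polyC size_scale ?expf_neq0 //.
have := size_exp B' p; have := size_polyD B' (k *: (P * d%:P)).
rewrite size_scale // [P * _]mulrC mul_polyC size_scale //.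
have : (0 < size B')%N by rewrite size_poly_gt0.
have : (0 < size (B' ^+ p))%N by rewrite size_poly_gt0 expf_neq0.
move: (size B') (size (B' ^+ p)) (size (B' + _)) (size P) sP => i j t u.
by rewrite /p; clear -m0; nia.
Qed.
End LegendreCubic.

Section OddCharacteristic.
Variables (K : closedFieldType) (F : fieldType) (s : {rmorphism K -> F}).
Variables (x y : F) (l : K) (m : nat).
Let p := m.*2.+1.
Hypotheses (hp : p \in [pchar K]) (m0 : (0 < m)%N) (l0 : l != 0) (l1 : l != 1).
Hypotheses (gens : quadratic_gens s x y).
Local Notation g := (legendre_cubic l).
Hypothesis yE : y ^+ 2 = ev s x g.
(* The Hasse invariant of the curve. *)
Hypothesis hasse : (g ^+ m)`_(m.*2) != 0.

(** With G = g^m one has y^p = G(x) y. Split G = T + H X^(p-1) + P X^p, H being the Hasse invariant.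
    For f = c y/x with c^p H = c the middle term of f^p cancels f, so f^p - f = c^p P(x) y + c^p
    T(x) y/x^p; the first summand is [h], and the second is regular at infinity. *)
Lemma odd_locally_split : exists h : F, everywhere_locally_split p h.
Proof.
have [G GE0] : exists G, G = g ^+ m by eexists.
have hasseG : G`_(m.*2) != 0 by rewrite GE0.
have hF := rmorph_pchar s hp; have [gen free] := gens.
have p1 : (1 < p)%N := prime_gt1 (pcharf_prime hp).
have [c cE] : exists c, c ^+ p * G`_(m.*2) = c /\ c != 0.
  have m20 : (0 < m.*2)%N by rewrite double_gt0.
  have [c cE] := closed_nth_root (G`_(m.*2))^-1 m20.
  exists c; split; first by rewrite exprS cE mulfVK.
  by apply: contraTneq hasseG => c0; rewrite -invr_eq0 -cE c0 expr0n gtn_eqF // eqxx.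
case: cE => cE c0.
pose P := drop_poly p G; pose T := take_poly m.*2 G.
have GE : G = T + (G`_(m.*2))%:P * 'X ^+ (m.*2) + P * 'X ^+ p.
  rewrite -{1}(poly_take_drop p G) /P; congr (_ + _).
  apply/polyP => i; rewrite coefD coefCM coefXn !coef_take_poly ltnS leq_eqVlt.
  by case: ltngtP => [_|_|->]; rewrite ?mulr0 ?mulr1 ?addr0 ?add0r.
have Gmonic : G \is monic by rewrite GE0 monic_exp ?legendre_cubic_monic.
have sG : size G = (3 * m).+1.
  have := size_exp g m; rewrite size_legendre_cubic -GE0 => <-.
  by rewrite prednK // size_poly_gt0 monic_neq0.
have sP : size P = m by rewrite size_drop_poly sG /p; lia.
have P0 : P != 0 by rewrite -size_poly_gt0 sP.
have ypE : y ^+ p = ev s x G * y by rewrite /p exprSr -mul2n exprM yE GE0 evXn.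
pose h := s (c ^+ p) * ev s x P * y; exists h; split=> [z zE|v].
  have [A [B [D [D0 zD]]]] := gen z.
  have Dn0 : D != 0 by apply: contraNneq D0 => ->; rewrite ev0.
  have [|_] := free (A ^+ p - A * D ^+ p.-1)
    (B ^+ p * G - B * D ^+ p.-1 - c ^+ p *: (P * D ^+ p)).
    rewrite -mul_polyC !evD !evN !evM !evXn evC.
    transitivity ((ev s x A + ev s x B * y) ^+ p
       - (ev s x A + ev s x B * y) * ev s x D ^+ p.-1 - h * ev s x D ^+ p).
      rewrite (exprpD hF) exprMn ypE /h.
      move: (ev s x A ^+ p) (ev s x B ^+ p) (ev s x D ^+ p.-1)
        (ev s x D ^+ p) => *; ring.
    have Dp : ev s x D ^+ p = ev s x D * ev s x D ^+ p.-1 by rewrite -exprS.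
    rewrite -zD exprMn -zE Dp.
    by move: (ev s x D ^+ p.-1) (z ^+ p) => *; ring.
  (* Only the coefficient of y is needed: it is the equation B^p g^m - B D^(p-1) = c^p P D^p. *)
  move/eqP; rewrite subr_eq0 => /eqP; rewrite GE0; apply: legendre_no_solution => //.
    by rewrite expf_neq0.
  by rewrite sP.
have [vx|vx] := boolP ((x != 0) && (v x < 0)); last first.
  have {}vx : vge v 0 x.
    have [->|x0] := eqVneq x 0; first exact: vge0.
    by move: vx; rewrite x0 /= -leNgt; right.
  have [|x1 vx1] := @residue_exists K F s v 0 g x y gens _ vx.
    by rewrite ev0 mul0r addr0.
  have [y1 y1E] := closed_nth_root g.[x1] (isT : (0 < 2)%N).
  have vy : vge v 0 y.
    have [->|y0] := eqVneq y 0; first exact: vge0.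
    have := vge_ev s g vx; rewrite -yE => /(vge_neq0 (expf_neq0 2 y0)).
    rewrite dvalX // => vy; right.
    by clear -vy; move: (v y) vy => i; lia.
  (* The product (y - y1)(y + y1) = g(x) - g(x1) has positive value, hence so does one factor. *)
  have [y2 vy2] : exists y2, vge v 1 (y - s y2).
    have := vge_ev_residue g vx1 vx; rewrite -yE -y1E rmorphXn subr_sqr.
    case/vge1_mul => [||vy1|vy1].
    - by apply: vgeB => //; apply: vge_const.
    - by apply: vgeD => //; apply: vge_const.
    - by exists y1.
    by exists (- y1); rewrite rmorphN opprK.
  have [k kE] := closed_artin_schreier (c ^+ p * P.[x1] * y2) p1.
  exists (s k); rewrite -rmorphXn -rmorphB kE /h !rmorphM.
  rewrite (_ : _ - _ = s (c ^+ p) * (ev s x P * (y - s y2)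
    + s y2 * (ev s x P - s P.[x1]))); last by ring.
  apply: vgeM0; first exact: vge_const.
  apply: vgeD; apply: vgeM0 => //; first exact: vge_ev.
    exact: vge_const.
  exact: vge_ev_residue.
have /andP[x0 vx0] := vx.
have gx : ev s x g = x * (x - s 1) * (x - s l).
  by rewrite /g !(evM, evD, evN, evX, evC).
have [x10 vx1] := dvalB_const s 1 x0 vx0; have [xl0 vxl] := dvalB_const s l x0 vx0.
have y0 : y != 0.
  by rewrite -sqrf_eq0 yE gx !mulf_neq0.
have vy : v y *+ 2 = v x *+ 3.
  by rewrite -dvalX // yE gx !dvalM ?mulf_neq0 // vx1 vxl !mulrS mulr0n addr0 addrA.
exists (s c * y / x).
have -> : h - ((s c * y / x) ^+ p - s c * y / x)
    = - (s (c ^+ p) * (ev s x T * x^-1 ^+ m.*2.-1) * (y * x^-1 ^+ 2)).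
  have xp : x ^+ p * x^-1 ^+ p = 1 by rewrite -exprMn mulfV // expr1n.
  have x2m : x ^+ m.*2 * x^-1 ^+ p = x^-1.
    by rewrite [x^-1 ^+ p]exprSr mulrA -exprMn mulfV // expr1n mul1r.
  have ip : x^-1 ^+ p = x^-1 ^+ m.*2.-1 * x^-1 ^+ 2.
    by rewrite -exprD addn2 prednK ?double_gt0.
  have sc : s c = s (c ^+ p) * s G`_(m.*2) by rewrite -rmorphM cE.
  transitivity (s (c ^+ p) * ev s x P * y - (s (c ^+ p) * (ev s x G * y) * x^-1 ^+ p
      - s c * y / x)).
    by rewrite /h !exprMn ypE !rmorphXn.
  rewrite {1}GE !evD !evM !evXn evC evX sc.
  transitivity (s (c ^+ p) * ev s x P * y * (1 - x ^+ p * x^-1 ^+ p)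
     + s (c ^+ p) * s G`_(m.*2) * y * (x^-1 - x ^+ m.*2 * x^-1 ^+ p)
     - s (c ^+ p) * ev s x T * y * x^-1 ^+ p).
    move: (x ^+ p) (x^-1 ^+ p) (x ^+ m.*2) => *; ring.
  rewrite xp x2m ip; move: (x^-1 ^+ _) (x^-1 ^+ 2) => *; ring.
(* T has degree at most p - 2, so T(x) / x^(p-2) is integral. The factor left is y/x^2, of value
   -v(x)/2 > 0 because 2 v(y) = 3 v(x). *)
apply/vgeN/vgeM0.
  apply: vgeM0; first exact: vge_const.
  apply: vge_ev_pole => //; rewrite prednK ?double_gt0 //.
  exact: size_take_poly.
right; rewrite dvalM ?expf_neq0 ?invr_eq0 // dvalX ?invr_eq0 // dvalV //.
by clear -vy vx0; move: (v x) (v y) vy vx0 => i j; lia.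
Qed.
End OddCharacteristic.

(** * Changes of variables *)

Lemma wsmoothP (K : fieldType) (W : weierstrass K) :
  wsmooth W <-> forall x y : K, ~ [/\ weval W idfun x y = 0,
    wa1 W * y - (3%:R * x ^+ 2 + 2%:R * wa2 W * x + wa4 W) = 0
    & 2%:R * y + wa1 W * x + wa3 W = 0].
Proof.
have evalE (P : 'I_2 -> K) :
    (wpoly W).@[P] = weval W idfun (P (inord 0)) (P (inord 1)).
  rewrite [LHS]weval_map /= /wvarx /wvary !mevalXU.
  by rewrite /weval /= !mevalC.
have i01 : (inord 0 == inord 1 :> 'I_2) = false by rewrite -val_eqE /= !inordK.
have i10 : (inord 1 == inord 0 :> 'I_2) = false by rewrite eq_sym.
have dX (i j : 'I_2) : ('X_i : {mpoly K[2]})^`M(j) = (i == j)%:R%:MP.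
  rewrite mderivX mnm1E; case: eqP => [->|_]; last by rewrite scale0r mpolyC0.
  by rewrite -{1}[U_(j)%MM]addm0 addmC addmK mpolyX0 scale1r mpolyC1.
have derE (P : 'I_2 -> K) :
    ((wpoly W)^`M(inord 0)).@[P] = wa1 W * P (inord 1)
      - (3%:R * P (inord 0) ^+ 2 + 2%:R * wa2 W * P (inord 0) + wa4 W) /\
    ((wpoly W)^`M(inord 1)).@[P] = 2%:R * P (inord 1) + wa1 W * P (inord 0) + wa3 W.
  rewrite /wpoly /weval /wvarx /wvary !exprS !expr0 !mulr1.
  rewrite !(mderivB, mderivD, mderivM, mderivC, dX) !eqxx i01 i10.
  rewrite !(mevalD, mevalB, mevalN, mevalM, mevalXU, mevalC).
  by rewrite !mulr0n !mulr1n; split; ring.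
split=> [sm x y [w0 wx wy]|sm P [w0 wd]].
  pose P i := if i == inord 0 :> 'I_2 then x else y.
  have [PX PY] : P (inord 0) = x /\ P (inord 1) = y by rewrite /P eqxx i10.
  have [d0 d1] := derE P; apply: (sm P); rewrite evalE PX PY; split=> //.
  by apply: forall_I2; rewrite ?d0 ?d1 PX PY.
have [d0 d1] := derE P; apply: (sm (P (inord 0)) (P (inord 1))).
by rewrite -evalE -d0 -d1; split.
Qed.

(* A change of variables as in [elliptic_iso], over every K-algebra. *)
Definition admissible_change (K : fieldType) (C D : weierstrass K) : Prop :=
  exists u r a t : K, u != 0 /\
    forall (R : comNzRingType) (s : {rmorphism K -> R}) (x y : R),
      weval C s (s (u ^+ 2) * x + s r)
        (s (u ^+ 3) * y + s (u ^+ 2 * a) * x + s t)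
      = s (u ^+ 6) * weval D s x y.

Lemma admissible_change_iso (K : closedFieldType) (C D : ellipticCurve K) :
  admissible_change C D -> elliptic_iso C D.
Proof.
move=> [u [r [a [t [u0 h]]]]]; exists u, r, a, t; split=> //.
by rewrite -!mul_mpolyC; apply: h.
Qed.

Lemma admissible_change_gens (K F : fieldType) (s : {rmorphism K -> F})
    (C D : weierstrass K) x y :
  admissible_change C D -> weval C s x y = 0 -> quadratic_gens s x y ->
  exists x' y', weval D s x' y' = 0 /\ quadratic_gens s x' y'.
Proof.
move=> [u [r [a [t [u0 h]]]]] xy0 gens.
have su0 : s u != 0 by rewrite fmorph_eq0.
pose x' := (x - s r) / s (u ^+ 2).
pose y' := (y - s (u ^+ 2 * a) * x' - s t) / s (u ^+ 3).
have xE : x = s (u ^+ 2) * x' + s r.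
  by rewrite /x' [s (u ^+ 2)]rmorphXn; field.
have yE : y = s (u ^+ 3) * y' + s (u ^+ 2 * a) * x' + s t.
  by rewrite /y' [s (u ^+ 3)]rmorphXn; field.
exists x', y'; split; last first.
  by apply: (quadratic_gens_subst gens _ _ xE yE); rewrite expf_neq0.
have := h F s x' y'; rewrite -xE -yE xy0 => /esym/eqP.
by rewrite mulf_eq0 fmorph_eq0 expf_eq0 (negPf u0) => /eqP.
Qed.

(** * Legendre form away from characteristic two *)

Section Legendre.
Variables (K : closedFieldType).

Definition legendre_curve (l : K) := Weierstrass 0 (- (1 + l)) 0 l 0.

Lemma legendre_weval (F : fieldType) (s : {rmorphism K -> F}) l x y :
  weval (legendre_curve l) s x y = y ^+ 2 - ev s x (legendre_cubic l).
Proof.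
rewrite /weval /legendre_cubic /= !evE !(rmorph0, rmorphN, rmorphD, rmorph1); ring.
Qed.

Lemma cubic_roots (b c d : K) : exists e1 e2 e3,
  [/\ b = - (e1 + e2 + e3), c = e1 * e2 + e1 * e3 + e2 * e3 & d = - (e1 * e2 * e3)].
Proof.
(* [e1] is a root of X^3 + b X^2 + c X + d, [e2] a root of its quotient by X - e1, and the third
   root comes from the sum of the roots. *)
have [e1 e1E] := @solve_monicpoly K 3 (nth 0 [:: - d; - c; - b]) isT.
have [e2 e2E] := @solve_monicpoly K 2 (nth 0 [:: - (c + e1 * (b + e1)); - (b + e1)]) isT.
move: e1E e2E; rewrite !big_ord_recl !big_ord0 /= /bump /= => e1E e2E.
exists e1, e2, (- (b + e1 + e2)); split; first by ring.
  have -> : e1 * e2 + e1 * - (b + e1 + e2) + e2 * - (b + e1 + e2)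
    = - e1 * (b + e1) - (b + e1) * e2 - e2 ^+ 2 by ring.
  by rewrite e2E; ring.
have -> : - (e1 * e2 * - (b + e1 + e2)) = e1 * (e2 ^+ 2 + (b + e1) * e2) by ring.
rewrite e2E.
transitivity (- (e1 ^+ 3) - b * e1 ^+ 2 - c * e1); first by rewrite e1E; ring.
by ring.
Qed.

Hypothesis two0 : 2%:R != 0 :> K.

Lemma legendre_smooth l : l != 0 -> l != 1 -> wsmooth (legendre_curve l).
Proof.
move=> l0 l1; apply/wsmoothP => x y [w0 /= wx wy].
have /eqP : 2%:R * y = 0 by rewrite -wy; ring.
rewrite mulf_eq0 (negPf two0) => /eqP y0; move: w0 wx; rewrite y0 /weval /=.
move=> w0 wx; have /eqP : x * (x - 1) * (x - l) = 0.
  by apply/eqP; rewrite -oppr_eq0 -w0; apply/eqP; ring.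
rewrite !mulf_eq0 !subr_eq0 -orbA => /or3P[]/eqP xE; move/eqP: wx; rewrite xE.
- by rewrite (_ : _ - _ = - l) ?oppr_eq0 ?(negPf l0) //; ring.
- by rewrite (_ : _ - _ = l - 1) ?subr_eq0 ?(negPf l1) //; ring.
- by rewrite (_ : _ - _ = - (l * (l - 1))) ?oppr_eq0 ?mulf_eq0 ?subr_eq0
    ?(negPf l0) ?(negPf l1) //; ring.
Qed.

(** Completing the square in y leaves a cubic with roots e1, e2, e3. A double root e would give the
    singular point (e, -(al e + be)). The affine map with u^2 = e2 - e1 takes e1, e2 to 0, 1, and
    [l] is the image of e3. *)
Lemma legendre_form (C : weierstrass K) : wsmooth C ->
  exists l, [/\ l != 0, l != 1 & admissible_change C (legendre_curve l)].
Proof.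
case: C => a1 a2 a3 a4 a6 /wsmoothP /= sm.
have [al a1E] : exists al, a1 = 2%:R * al by exists (a1 / 2%:R); field.
have [be a3E] : exists be, a3 = 2%:R * be by exists (a3 / 2%:R); field.
have [e1 [e2 [e3 [bE cE dE]]]] :=
  cubic_roots (a2 + al ^+ 2) (a4 + 2%:R * al * be) (a6 + be ^+ 2).
have a2E : a2 = - (e1 + e2 + e3) - al ^+ 2 by rewrite -bE addrK.
have a4E : a4 = e1 * e2 + e1 * e3 + e2 * e3 - 2%:R * al * be by rewrite -cE addrK.
have a6E : a6 = - (e1 * e2 * e3) - be ^+ 2 by rewrite -dE addrK.
have distinct e e' : e1 + e2 + e3 = e + e + e' ->
    e1 * e2 + e1 * e3 + e2 * e3 = e * e + e * e' + e * e' ->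
    e1 * e2 * e3 = e * e * e' -> False.
  move=> h1 h2 h3; apply: (sm e (- (al * e + be))); rewrite /weval /=.
  by rewrite a1E a3E a2E a4E a6E h1 h2 h3; split; ring.
have e12 : e2 - e1 != 0.
  by apply/eqP => /subr0_eq e12; apply: (distinct e1 e3); rewrite e12; ring.
have e13 : e3 - e1 != 0.
  by apply/eqP => /subr0_eq e13; apply: (distinct e1 e2); rewrite e13; ring.
have e23 : e3 - e2 != 0.
  by apply/eqP => /subr0_eq e23; apply: (distinct e2 e1); rewrite e23; ring.
have [u uE] := closed_nth_root (e2 - e1) (isT : (0 < 2)%N).
have u0 : u != 0 by apply: contraNneq e12 => u0; rewrite -uE u0 expr0n.
exists ((e3 - e1) / (e2 - e1)); split.
- by rewrite mulf_neq0 ?invr_eq0.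
- rewrite -subr_eq0 (_ : _ - 1 = (e3 - e2) / (e2 - e1)); last by field.
  by rewrite mulf_neq0 ?invr_eq0.
set l := _ / _; have e2E : e2 = e1 + u ^+ 2 by rewrite uE addrC subrK.
have e3E : e3 = e1 + u ^+ 2 * l by rewrite uE /l; field.
exists u, e1, (- al), (- (al * e1 + be)); split=> // R s x y.
rewrite /weval /= a2E a4E a6E a1E a3E e3E e2E.
move: {uE a2E a4E a6E e2E e3E bE cE dE distinct e12 e13 e23} l => l.
rewrite !(rmorph0, rmorphB, rmorphN, rmorphD, rmorphM, rmorphXn, rmorph1, rmorph_nat) /=.
by ring.
Qed.
End Legendre.

(** * Normal forms in characteristic two *)

Section CharacteristicTwoForms.
Variables (K : closedFieldType) (h2 : 2%N \in [pchar K]).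

(** The curve y^2 + y = x^3, of j-invariant 0. *)
Definition supersingular2 : weierstrass K := Weierstrass 0 0 1 0 0.

Lemma supersingular2_smooth : wsmooth supersingular2.
Proof.
apply/wsmoothP => x y [_ _ /= /eqP].
by rewrite (pcharf0 h2) !mul0r !add0r oner_eq0.
Qed.

Lemma two_mul0 (z : K) : 2%:R * z = 0.
Proof. by rewrite (pcharf0 h2) mul0r. Qed.

(* The coefficients are rewritten modulo 2 so that the change of variables is
   an identity over the integers. *)
Lemma supersingular2_form (C : weierstrass K) :
  wsmooth C -> wa1 C = 0 -> admissible_change C supersingular2.
Proof.
case: C => a1 a2 a3 a4 a6 /wsmoothP /= sm a1_0.
(* If a1 = a3 = 0 in characteristic two, the point of the curve with x^2 = a4 is singular. *)
have a3_0 : a3 != 0.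
  apply/eqP => a3_0; have [x xE] := closed_nth_root a4 (isT : (0 < 2)%N).
  have [y yE] := closed_nth_root (x ^+ 3 + a2 * x ^+ 2 + a4 * x + a6) (isT : (0 < 2)%N).
  apply: (sm x y); rewrite /weval /= a1_0 a3_0 yE; split; first by ring.
    transitivity (- (x ^+ 2 - a4) - 2%:R * (x ^+ 2 + a2 * x + a4)); first by ring.
    by rewrite xE two_mul0; ring.
  by rewrite two_mul0; ring.
have [u uE] := closed_nth_root a3 (isT : (0 < 3)%N).
have u0 : u != 0 by apply: contraNneq a3_0 => u0; rewrite -uE u0 expr0n.
(* With r = a2 + a^2 killing the coefficient of x^2, the one of x becomes a4 + a a3 + r^2 modulo 2;
   its vanishing is this quartic in a. The quadratic for t then removes the constant term. *)
have [a] := @solve_monicpoly K 4 (nth 0 [:: a4 - a2 ^+ 2; - a3]) isT.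
rewrite !big_ord_recl !big_ord0 /= /bump /= => aE.
have [r rE] : exists r, r = a2 + a ^+ 2 by eexists.
have [t] := @solve_monicpoly K 2
  (nth 0 [:: r * a4 + r ^+ 2 * a2 + r ^+ 3 + a6; - a3]) isT.
rewrite !big_ord_recl !big_ord0 /= /bump /= => tE.
have a1E : a1 = - (2%:R * a) by rewrite two_mul0 a1_0 oppr0.
have a3E : a3 = u ^+ 3 - 2%:R * t - r * a1 by rewrite uE two_mul0 a1_0; ring.
have a2E : a2 = a * a1 - 3%:R * r + a ^+ 2.
  transitivity (a2 + a * a1 - 2%:R * (2%:R * a2 + a ^+ 2)).
    by rewrite two_mul0 a1_0; ring.
  by rewrite rE; ring.
have a4E : a4 = a * a3 - 2%:R * r * a2 + (t + r * a) * a1 - 3%:R * r ^+ 2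
    + 2%:R * a * t.
  transitivity (a * a3 + r ^+ 2 - 2%:R * (r * a2 + 2%:R * r ^+ 2 - a * t)
     + (t + r * a) * a1); last by ring.
  rewrite two_mul0 a1_0.
  transitivity (a4 - a2 ^+ 2 + - a3 * a + a * a3 + a2 ^+ 2); first by ring.
  transitivity (a ^+ 4 + a * a3 + a2 ^+ 2 + 2%:R * (a2 * a ^+ 2)).
    by rewrite aE two_mul0; ring.
  by rewrite rE; ring.
have a6E : a6 = - (r * a4 + r ^+ 2 * a2 + r ^+ 3 - t * a3 - t ^+ 2 - r * t * a1).
  rewrite a1_0 tE.
  transitivity (a6 - 2%:R * (t * a3) + 2%:R * (t * a3)).
    by rewrite subrK.
  ring.
exists u, r, a, t; split=> // R s x y.
move: {aE tE uE rE a1_0 a3_0 sm} a1E a3E a2E a4E a6E => a1E a3E a2E a4E a6E.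
rewrite /weval /= a6E a4E a2E a3E a1E.
rewrite !(rmorph0, rmorphB, rmorphN, rmorphD, rmorphM, rmorphXn, rmorph1, rmorph_nat) /=.
by ring.
Qed.

(** The shift r = -a3/a1 removes a3 modulo 2, t removes a6, and u = a1 normalizes a1 to 1. If b were
    0, the new origin (r, t) would be a singular point of [C]. *)
Lemma ordinary2_form (C : weierstrass K) : wsmooth C -> wa1 C != 0 ->
  exists a b, b != 0 /\ admissible_change C (Weierstrass 1 a 0 b 0).
Proof.
case: C => a1 a2 a3 a4 a6 /wsmoothP /= sm a1_0.
have [r rE] : exists r, r = - a3 / a1 by eexists.
have [t tE] := closed_nth_root (- (a6 + r ^+ 3 + a2 * r ^+ 2 + a4 * r))
  (isT : (0 < 2)%N).
have a3E : a3 = - (a1 * r) - 2%:R * t by rewrite two_mul0 rE; field.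
have a6E : a6 = - t ^+ 2 - r ^+ 3 - a2 * r ^+ 2 - a4 * r by rewrite tE; ring.
have [a aE] : exists a, a = (3%:R * r + a2) / a1 ^+ 2 by eexists.
have [b bE] : exists b, b = (3%:R * r ^+ 2 + 2%:R * a2 * r + a4 - a1 * t) / a1 ^+ 4.
  by eexists.
have a2E : a2 = a1 ^+ 2 * a - 3%:R * r by rewrite aE; field.
have a4E : a4 = a1 ^+ 4 * b + a1 * t - 3%:R * r ^+ 2 - 2%:R * a2 * r.
  by rewrite bE; field.
exists a, b; split.
  apply/eqP => b0; apply: (sm r t); split.
  - by rewrite /weval /= a6E a3E; ring.
  - by rewrite a4E b0; ring.
  - by rewrite a3E; ring.
exists a1, r, 0, t; split=> // R s x y.
rewrite /weval /= a6E a4E a2E a3E.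
rewrite !(rmorph0, rmorphB, rmorphN, rmorphD, rmorphM, rmorphXn, rmorph1, rmorph_nat) /=.
by ring.
Qed.
End CharacteristicTwoForms.

(** * The local-global principle *)

Section Hasse.
Variables (K : closedFieldType) (m : nat).

(** The coefficient is computed with the Legendre parameter as a variable. It is a nonzero
    polynomial: at l = 0 it is the coefficient of X^(2m) in X^(2m) (X - 1)^m, which is (-1)^m. *)
Lemma hasse_poly : exists2 H : {poly K}, H != 0 &
  forall l, H.[l] = (legendre_cubic l ^+ m)`_(m.*2).
Proof.
pose H : {poly K} :=
  (('X * ('X - 1%:P) * ('X - ('X)%:P)) ^+ m : {poly {poly K}})`_(m.*2).
have HE l : H.[l] = (legendre_cubic l ^+ m)`_(m.*2).
  rewrite -horner_evalE -coef_map rmorphXn !rmorphM !rmorphB /= !map_polyX !map_polyC /=.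
  by rewrite !horner_evalE hornerX hornerC.
exists H => //; apply/eqP => H0; have := HE 0; rewrite H0 horner0 /legendre_cubic subr0.
rewrite [_ * 'X]mulrAC -expr2 exprMn -exprM mul2n coefXnM ltnn subnn => /esym/eqP.
rewrite -horner_coef0 horner_exp hornerXsubC sub0r expf_eq0 oppr_eq0 oner_eq0.
by rewrite andbF.
Qed.

Lemma legendre_family (r : seq K) : 2%:R != 0 :> K ->
  exists (n : nat) (E : 'I_n -> ellipticCurve K), forall l, l \in r ->
    l != 0 -> l != 1 -> exists i, ecurve (E i) = legendre_curve l.
Proof.
move=> two0; elim: r => [|l r [n [E IH]]].
  have E : 'I_0 -> ellipticCurve K by case.
  by exists 0%N, E.
have [l01|] := boolP ((l != 0) && (l != 1)); last first.
  move=> l01; exists n, E => k; rewrite inE => /predU1P[->|] k0 k1.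
    by rewrite k0 k1 in l01.
  exact: IH.
have /andP[l0 l1] := l01; pose D := EllipticCurve (legendre_smooth two0 l0 l1).
exists n.+1, (fun i => if unlift ord0 i is Some j then E j else D).
move=> k; rewrite inE => /predU1P[-> _ _|kr k0 k1].
  by exists ord0; rewrite unlift_none.
by have [i iE] := IH _ kr k0 k1; exists (lift ord0 i); rewrite liftK.
Qed.
End Hasse.

Lemma locally_split_levi (F : fieldType) (p : nat) (h : F) :
  p \in [pchar F] -> everywhere_locally_split p h ->
  (exists f : F, as_nontrivial p f /\
     forall (v : discreteValuation F) (Fv : fieldType) (iota : {rmorphism F -> Fv}),
       is_completion v iota -> as_splits_over p f iota) /\
  (exists G : groupScheme F,
     [/\ is_linear_algebraic_group G, unipotent_radical_defined G,
         ~ has_levi_factor G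
       & forall (v : discreteValuation F) (Fv : fieldType)
                (iota : {rmorphism F -> Fv}),
           is_completion v iota -> has_levi_factor (base_change iota G)]).
Proof.
move=> hp [h_nt h_loc].
have nt : as_nontrivial p h.
  by case=> y; rewrite root_artin_schreier => /eqP; apply: h_nt.
have loc (v : discreteValuation F) (Fv : fieldType) (iota : {rmorphism F -> Fv}) :
    is_completion v iota -> as_splits_over p h iota.
  move=> compl; have [g vg] := h_loc v.
  have [y yE] := local_splitting hp vg compl.
  by exists y; rewrite map_artin_schreier root_artin_schreier yE.
split; first by exists h.
exists (tw_group hp h); split.
- exact: (tw_smooth hp (tw_gE p h)).
- by eexists; exact: (tw_unipotent_radical hp _ _ (tw_gE p h)).
- exact: tw_group_no_levi.
by move=> v Fv iota /loc; apply: tw_group_levi.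
Qed.

Theorem proposition3p5 (K : closedFieldType) (p : nat) (hp : p \in [pchar K]) :
  exists (n : nat) (E : 'I_n -> ellipticCurve K),
    forall C : ellipticCurve K, (forall i : 'I_n, ~ elliptic_iso C (E i)) ->
    forall (F : fieldType) (s : {rmorphism K -> F}), is_function_field C s ->
      (exists f : F, as_nontrivial p f /\
         forall (v : discreteValuation F) (Fv : fieldType)
                (iota : {rmorphism F -> Fv}),
           is_completion v iota -> as_splits_over p f iota)
      /\
      (exists G : groupScheme F,
         [/\ is_linear_algebraic_group G,
             unipotent_radical_defined G,
             ~ has_levi_factor G
           & forall (v : discreteValuation F) (Fv : fieldType)
                    (iota : {rmorphism F -> Fv}),
               is_completion v iota ->
               has_levi_factor (base_change iota G)]).
Proof.
have [p2|p2] := eqVneq p 2%N.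
  move: hp; rewrite p2 => {p p2} h2.
  (* In characteristic two a single curve is excluded: every smooth curve with a1 = 0 is isomorphic
     to it. *)
  exists 1%N, (fun=> EllipticCurve (supersingular2_smooth h2)) => -[C smC] C_ord F s Ff.
  have a1_0 : wa1 C != 0.
    apply/eqP => a1_0; apply: (C_ord ord0); apply: admissible_change_iso.
    exact: supersingular2_form.
  have [x [y [xyC gens]]] := function_field_gens Ff.
  have [a [b [b0 CD]]] := ordinary2_form h2 smC a1_0.
  have [x' [y' [xyD gens']]] := admissible_change_gens CD xyC gens.
  apply: (locally_split_levi (rmorph_pchar s h2)).
  apply: (char2_locally_split (a := a) h2 b0 gens').
  move: xyD; rewrite /weval /= rmorph0 rmorph1 mul1r mul0r !addr0 => /eqP.
  by rewrite subr_eq0 => /eqP.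
have p_pr := pcharf_prime hp.
have two0 : 2%:R != 0 :> K.
  by rewrite -(dvdn_pcharf hp) dvdn_prime2.
have pE : p = p./2.*2.+1.
  by rewrite -[LHS]odd_double_half; case: (even_prime p_pr) p2 => [->|->].
have m0 : (0 < p./2)%N by rewrite half_gt0 prime_gt1.
move: hp; rewrite pE; move: (p./2) m0 => m m0 hp.
(* The excluded curves are the Legendre curves whose parameter is one of the finitely many roots of
   [H]. *)
have [H H0 HE] := hasse_poly K m.
have [r rE] := closed_field_poly_normal H.
have [n [E EP]] := legendre_family r two0.
exists n, E => -[C smC] C_ord F s Ff.
have [l [l0 l1 CD]] := legendre_form two0 smC.
have hasse : (legendre_cubic l ^+ m)`_(m.*2) != 0.
  rewrite -HE; apply/negP => lH.
  have lr : l \in r.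
    move: lH; rewrite -/(root H l) rE rootZ ?lead_coef_eq0 //.
    by rewrite root_prod_XsubC.
  have [i iE] := EP l lr l0 l1; apply: (C_ord i); apply: admissible_change_iso.
  by rewrite iE.
have [x [y [xyC gens]]] := function_field_gens Ff.
have [x' [y' [xyD gens']]] := admissible_change_gens CD xyC gens.
move: xyD; rewrite legendre_weval => /eqP; rewrite subr_eq0 => /eqP yE.
have [h hE] := odd_locally_split hp m0 l0 l1 gens' yE hasse.
exact: (locally_split_levi (rmorph_pchar s hp) hE).
Qed.
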